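(* $\mathsf{TC}_{\omega^\omega}<^{\mathrm a}_{\mathrm W}\mathsf{LL}_{\bm{\Sigma}^0_1}$; that is, $\mathsf{TC}_{\omega^\omega}\leq^{\mathrm a}_{\mathrm W}\mathsf{LL}_{\bm{\Sigma}^0_1}$ and $\mathsf{LL}_{\bm{\Sigma}^0_1}\nleq^{\mathrm a}_{\mathrm W}\mathsf{TC}_{\omega^\omega}$.
   Context: Arithmetical Weihrauch reducibility: for partial multi-valued functions $f,g$ between represented spaces, a realizer of $g$ is a partial $G$ on $\omega^\omega$ sending each name of each $x\in\mathrm{dom}(g)$ to a name of an element of $g(x)$. $f\leq^{\mathrm a}_{\mathrm W}g$ if there are arithmetical partial functions $\varphi,\psi$ on $\omega^\omega$ such that for every realizer $G$ of $g$, $p\mapsto\psi(\langle p,G(\varphi(p))\rangle)$ is a realizer of $f$. An open subset of $\omega^\omega$ is named by an enumeration of a set $A\subseteq\omega^{<\omega}$ with the open set equal to $\{f:\exists\tau\prec f\ (\tau\in A)\}$. A Laver tree (always with empty stem) is a prefix-closed $T\subseteq\omega^{<\omega}$ containing $\langle\rangle$ such that every $\sigma\in T$ has infinitely many immediate successors in $T$; $[T]$ is the set of infinite paths. $\mathrm{LT}:\omega^\omega\to\{\text{Laver trees}\}$ is a total bijective representation of Laver trees, computably equivalent to the representation via characteristic functions. $\mathsf{LL}_{\bm{\Sigma}^0_1}:\bm{\Sigma}^0_1(\omega^\omega)\rightrightarrows\omega^\omega$ maps an open set $A$ to $\{f:[\mathrm{LT}(f)]\subseteq A\ \lor\ [\mathrm{LT}(f)]\cap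 A=\emptyset\}$. $\mathsf{TC}_{\omega^\omega}$ is the totalization of closed choice on Baire space: it maps a tree $T\subseteq\omega^{<\omega}$ to $[T]$ if $[T]\neq\emptyset$, and to $\omega^\omega$ (any output allowed) otherwise. *)

(* Defs.v *)
From mathcomp Require Import all_boot.
From mathcomp Require Import boolp classical_sets cardinality.

Set Implicit Arguments.
Unset Strict Implicit.
Unset Printing Implicit Defensive.

Local Open Scope classical_set_scope.

Definition baire : Type := nat -> nat.

Definition bpair (p q : baire) : baire :=
  fun n => if odd n then q n./2 else p n./2.

(** * Oracle computability: Kleene's recursive functions relative to [p] *)

Inductive prog : Type :=
| Zero
| Succ
| Proj of nat
| Oracle
| Comp of prog & seq prog
| Rec of prog & prog
| Mu of prog.

(* [eval p e v y]: program [e] with oracle [p] halts on the arguments [v] with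
   output [y].  Programs carry no arity; a missing argument is read as 0. *)
Fixpoint eval (p : baire) (e : prog) (v : seq nat) (y : nat) {struct e} : Prop :=
  match e with
  | Zero => y = 0
  | Succ => y = (head 0 v).+1
  | Proj i => y = nth 0 v i
  | Oracle => y = p (head 0 v)
  | Comp f gs =>
      exists w : seq nat,
        (fix evals (gs : seq prog) (w : seq nat) {struct gs} : Prop :=
           match gs, w with
           | [::], [::] => True
           | g :: gs', z :: w' => eval p g v z /\ evals gs' w'
           | _, _ => False
           end) gs w /\ eval p f w y
  | Rec f g =>
      (fix rec (n y : nat) {struct n} : Prop :=
         match n with
         | 0 => eval p f (behead v) y
         | n'.+1 => exists z, rec n' z /\ eval p g [:: n', z & behead v] y
         end) (head 0 v) y
  | Mu f =>
      eval p f (y :: v) 0 /\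
      (forall z, z < y -> exists w, eval p f (z :: v) w.+1)
  end.

(* As usual in computable analysis, a partial function on Baire space is
   computable if some program computes it on its domain. *)
Definition computable (F : baire -> option baire) : Prop :=
  exists e : prog, forall p q, F p = Some q ->
    forall n, eval p e [:: n] (q n).

(** * Arithmetical relations and functions (lightface) *)

(* A relation on [baire * nat ^ k] is given by its values on the [v] of size [k]. *)
Definition recursive_rel (k : nat) (R : baire -> seq nat -> Prop) : Prop :=
  exists e : prog, forall p v, size v = k ->
    eval p e v (if `[< R p v >] then 1 else 0).

Inductive arithmetical_rel : nat -> (baire -> seq nat -> Prop) -> Prop :=
| arith_rec k R :
    recursive_rel k R -> arithmetical_rel k R
| arith_not k R :
    arithmetical_rel k R -> arithmetical_rel k (fun p v => ~ R p v)
| arith_and k R S :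
    arithmetical_rel k R -> arithmetical_rel k S ->
    arithmetical_rel k (fun p v => R p v /\ S p v)
| arith_ex k R :
    arithmetical_rel k.+1 R ->
    arithmetical_rel k (fun p v => exists n : nat, R p (n :: v)).

(* [F p n = m] is arithmetical in [p, n, m], for [p] in the domain of [F]. *)
Definition arithmetical (F : baire -> option baire) : Prop :=
  exists2 R, arithmetical_rel 2 R &
    forall p q, F p = Some q -> forall n m, R p [:: n; m] <-> q n = m.

(** * Represented spaces and Weihrauch reducibility *)

Record rep_space := RepSpace {
  carrier :> Type;
  names : baire -> carrier -> Prop;
  names_fun : forall p x y, names p x -> names p y -> x = y;
  names_surj : forall x, exists p, names p x
}.

(* Partial multi-valued functions; outside the domain the value set is empty. *)
Definition mvfun (X Y : rep_space) : Type := X -> set Y.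

Definition mvdom (X Y : rep_space) (f : mvfun X Y) : set X :=
  [set x | f x !=set0].

Definition realizer (X Y : rep_space) (f : mvfun X Y)
    (G : baire -> option baire) : Prop :=
  forall (p : baire) (x : X), names p x -> mvdom f x ->
    exists q (y : Y), [/\ G p = Some q, names q y & f x y].

(* The partial function [p |-> psi <p, G (phi p)>]. *)
Definition weihrauch_comp (phi psi G : baire -> option baire) :
    baire -> option baire :=
  fun p => obind (fun a => obind (fun b => psi (bpair p b)) (G a)) (phi p).

Definition aW_le (X Y Z W : rep_space) (f : mvfun X Y) (g : mvfun Z W) : Prop :=
  exists phi psi, [/\ arithmetical phi, arithmetical psi &
    forall G, realizer g G -> realizer f (weihrauch_comp phi psi G)].

Definition rep_le (X : Type) (d d' : baire -> X -> Prop) : Prop :=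
  exists2 F, computable F &
    forall p x, d p x -> exists2 q, F p = Some q & d' q x.

Definition rep_equiv (X : Type) (d d' : baire -> X -> Prop) : Prop :=
  rep_le d d' /\ rep_le d' d.

(** * The spaces involved *)

Lemma baire_names_surj (x : baire) : exists p, p = x.
Proof. by exists x. Qed.

Definition baire_space : rep_space :=
  @RepSpace baire (fun p x => p = x)
    (fun p x y (px : p = x) (py : p = y) => etrans (esym px) py)
    baire_names_surj.

(* Finite sequences are coded by the computable bijection [CodeSeq.code]. *)

(* [p] enumerates the set of all [s] with [p n = code s + 1] for some [n]; the
   value 0 lists nothing, so that the empty set is enumerated too. *)
Definition enumerated (p : baire) : set (seq nat) :=
  [set s | exists n, p n = (CodeSeq.code s).+1].

Definition char_name (p : baire) (T : set (seq nat)) : Prop :=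
  forall s, p (CodeSeq.code s) = if `[< T s >] then 1 else 0.

Definition open_of (W : set (seq nat)) : set baire :=
  [set f | exists2 t, W t & t = mkseq f (size t)].

Definition is_open (A : set baire) : Prop := exists W, A = open_of W.

Definition prefix_closed (T : set (seq nat)) : Prop :=
  forall s t, prefix s t -> T t -> T s.

Definition is_laver (T : set (seq nat)) : Prop :=
  [/\ prefix_closed T, T [::] &
      forall s, T s -> infinite_set [set n | T (rcons s n)]].

(* The set [T] of infinite paths. *)
Definition body (T : set (seq nat)) : set baire :=
  [set f | forall n, T (mkseq f n)].

Definition open_set : Type := {A : set baire | is_open A}.
Definition tree : Type := {T : set (seq nat) | prefix_closed T}.
Definition laver_tree : Type := {T : set (seq nat) | is_laver T}.

Definition open_names (p : baire) (A : open_set) : Prop :=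
  sval A = open_of (enumerated p).
Definition tree_names (p : baire) (T : tree) : Prop := char_name p (sval T).
Definition laver_names (p : baire) (T : laver_tree) : Prop :=
  char_name p (sval T).

Lemma char_name_fun p T U : char_name p T -> char_name p U -> T = U.
Proof.
move=> pT pU; apply/funext => s; apply/propext; have := pT s; rewrite pU.
by case: asboolP => Us; case: asboolP => Ts.
Qed.

Lemma tree_names_fun p T U : tree_names p T -> tree_names p U -> T = U.
Proof.
move=> pT pU; apply/eq_sig_hprop_iff; first by move=> *; exact: Prop_irrelevance.
exact: char_name_fun pT pU.
Qed.

Lemma tree_names_surj T : exists p, tree_names p T.
Proof.
exists (fun n => if `[< sval T (CodeSeq.decode n) >] then 1 else 0) => s.
by rewrite CodeSeq.codeK.
Qed.

Lemma open_names_fun p A B : open_names p A -> open_names p B -> A = B.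
Proof.
move=> pA pB; apply/eq_sig_hprop_iff; first by move=> *; exact: Prop_irrelevance.
exact: etrans pA (esym pB).
Qed.

Lemma open_names_surj A : exists p, open_names p A.
Proof.
case: A => A [W AW].
exists (fun n => if `[< W (CodeSeq.decode n) >] then n.+1 else 0).
rewrite /open_names /= AW; congr open_of; apply/seteqP; split=> s.
  move=> Ws; exists (CodeSeq.code s); rewrite CodeSeq.codeK.
  by case: asboolP.
by move=> [n]; case: asboolP => // Wn [nE]; move: Wn; rewrite nE CodeSeq.codeK.
Qed.

Definition open_space : rep_space := RepSpace open_names_fun open_names_surj.
Definition tree_space : rep_space := RepSpace tree_names_fun tree_names_surj.

(* [LT] is total and single-valued by its type; bijectivity is [bijective LT].
   Computable equivalence is with the characteristic-function representation. *)
Definition laver_representation (LT : baire -> laver_tree) : Prop :=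
  bijective LT /\ rep_equiv (fun p T => LT p = T) laver_names.

(** * The two problems *)

Definition TC_baire : mvfun tree_space baire_space :=
  fun T : tree => if `[< body (sval T) !=set0 >] then body (sval T) else setT.

Definition LL_open (LT : baire -> laver_tree) : mvfun open_space baire_space :=
  fun A : open_set =>
    [set f : baire | body (sval (LT f)) `<=` sval A \/
                     body (sval (LT f)) `&` sval A = set0].

(* Main.v *)
Require Import Defs.
From mathcomp Require Import all_boot zify.
From mathcomp Require Import boolp classical_sets cardinality.

Set Implicit Arguments.
Unset Strict Implicit.
Unset Printing Implicit Defensive.

Local Open Scope classical_set_scope.

(** Closed choice reduces to the open Laver problem because a Laver tree has
    paths above every function. Given a tree [T], let [A] be the open set of
    those [f] that bound no node of some level of [T]; by compactness the
    complement of [A] consists of the [f] that bound a path of [T]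
    ([open_of_unwitnessed]). If [T] has a path, then every Laver tree has a path
    above it, hence outside [A], so a homogeneous Laver tree must avoid [A].
    Its leftmost path then bounds a path of [T], and the leftmost one of these
    is arithmetical, again by compactness ([konig_pruned]).

    The converse fails by a diagonal argument. Let [phi] and [psi] be a
    reduction. Arithmetical functions are Borel, that is, they are projections
    of functions with closed graph ([arithmetical_extension]); so the tree
    [phi x] and the Laver tree named by [psi <x, a>] can be read off a
    certificate [H <x, a>], where [H] has a closed graph. To a point [x], read
    as a closed set of triples, assign the open set [A(x)] of those [f] for which
    no [g <= f] has [(x, g, f)] in the coded set; a name of [A(x)] depends
    continuously on [x]. Hence for each closed [K] some [e] satisfies
    [A(e) = {f | there is no g <= f with K(e, g, f)}]
    ([bounded_open_closed_code]). Let [T] be the tree that the reduction asks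
    about at [A(e)], and let [K(e, g, f)] hold if one of the following does.
    - [g] codes a path [a] of [T] together with a path [r] of the Laver tree
      [psi <e, a>] such that [r] belongs to [A(e)] ([inside_witness]);
    - [g] is the certificate of [psi <e, 0>], and [f] is the leftmost path above
      [g] of that Laver tree ([default_branch]).
    If the first case occurs for some [g], then no [f >= g] is in [A(e)], so all
    homogeneous Laver trees avoid [A(e)]; but [psi <e, a>] is homogeneous and
    has the path [r] in [A(e)]. If it never occurs, then at most one point is
    outside [A(e)], so all homogeneous Laver trees are inside [A(e)]. A path of
    [T] would then give a first case, so [T] has none. Every point, such as [0],
    is therefore an admissible answer, and [psi <e, 0>] is homogeneous; but the
    path of it singled out in the second case is outside [A(e)]. *)

(** * Trees, leftmost paths and Laver trees *)

Lemma take_mkseq (f : baire) m n : m <= n -> take m (mkseq f n) = mkseq f m.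
Proof. by move=> mn; rewrite /mkseq -map_take take_iota (minn_idPl mn). Qed.

Lemma prefix_nthP (s t : seq nat) :
  prefix s t <->
  size s <= size t /\ forall i, i < size s -> nth 0 s i = nth 0 t i.
Proof.
split=> [/prefixP[u ->]|[st E]].
  by split=> [|i si]; rewrite ?size_cat ?leq_addr // nth_cat si.
rewrite prefixE; apply/eqP/(@eq_from_nth _ 0); first by rewrite size_takel.
by move=> i; rewrite size_takel // => si; rewrite nth_take // E.
Qed.

Lemma prefix_rcons_nth (s t : seq nat) :
  prefix s t -> size s < size t -> prefix (rcons s (nth 0 t (size s))) t.
Proof.
case/prefixP=> u -> {t}; case: u => [|m u]; first by rewrite cats0 ltnn.
by rewrite nth_cat ltnn subnn /= -cat_rcons prefix_prefix.
Qed.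

(** Being lexicographically least among the initial segments of members of [B]
    is written without mention of infinite paths, so that [leftmost B] is
    arithmetical whenever [B] is. *)
Definition leftmost (B : set (seq nat)) : set (seq nat) :=
  [set s | B s /\ forall u i, B u -> i < size u -> i < size s ->
    (forall j, j < i -> nth 0 u j = nth 0 s j) -> nth 0 s i <= nth 0 u i].

Definition pruned (B : set (seq nat)) : Prop :=
  B [::] /\ forall s, B s -> exists m, B (rcons s m).

(** Without dead ends, always taking the least successor never gets stuck. *)
Lemma pruned_leftmost B : prefix_closed B -> pruned B ->
  exists g : baire, forall n, leftmost B (mkseq g n).
Proof.
move=> Bp [B0 Bs].
pose P s : pred nat := fun m => `[< B (rcons s m) >].
have /choice[c cP] s : exists m, B s -> P s m /\ forall k, P s k -> m <= k.
  have [Bx|nB] := pselect (B s); last by exists 0.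
  have exP : exists m, P s m by have [m Bm] := Bs s Bx; exists m; apply/asboolP.
  by case: (ex_minnP exP) => m Pm mmin; exists m.
pose pf n := iter n (fun s => rcons s (c s)) [::].
have szpf n : size (pf n) = n by elim: n => //= n IH; rewrite size_rcons IH.
exists (fun n => c (pf n)).
have E n : mkseq (fun n => c (pf n)) n = pf n.
  by elim: n => // n IH; rewrite mkseqS IH.
have Bpf n : B (pf n).
  by elim: n => //= n IH; have [/asboolP] := cP (pf n) IH.
move=> n; split; first by rewrite E.
move=> u i Bu iu; rewrite size_mkseq => ni uE; rewrite nth_mkseq //.
have [_ ->//] := cP (pf i) (Bpf i); apply/asboolP/(Bp _ u) => //.
have sE : pf i = take i u.
  apply: (@eq_from_nth _ 0); first by rewrite szpf size_takel // ltnW.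
  move=> j; rewrite szpf => ji; rewrite nth_take // uE // -E !nth_mkseq //.
  exact: leq_trans ji (ltnW ni).
by rewrite sE -take_nth // prefix_take.
Qed.

Lemma pruned_body B : prefix_closed B -> pruned B -> body B !=set0.
Proof. by move=> Bc /(pruned_leftmost Bc)[g gP]; exists g => n; case: (gP n). Qed.

Lemma leftmost_uniq B s t :
  leftmost B s -> leftmost B t -> size s = size t -> s = t.
Proof.
move=> [Bs ms] [Bt mt] st; apply: (@eq_from_nth _ 0) => // i.
elim/ltn_ind: i => i IH si; apply/eqP; rewrite eqn_leq ms ?mt -?st //.
  by move=> j ji; rewrite IH // (ltn_trans ji).
by move=> j ji; rewrite IH // (ltn_trans ji).
Qed.

(** Discarding small entries leaves a Laver tree without dead ends; this is how
    Laver trees come to have paths above every function. *)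
Definition above (L : set (seq nat)) (h : baire) : set (seq nat) :=
  [set s | L s /\ forall i, i < size s -> h i <= nth 0 s i].

Lemma above_tree L h : prefix_closed L -> prefix_closed (above L h).
Proof.
move=> Lp s t /[dup] st /prefix_nthP[szst E] [Lt ht]; split; first exact: Lp st Lt.
by move=> i si; rewrite E // ht // (leq_trans si).
Qed.

Lemma infinite_set_nat (A : set nat) :
  infinite_set A <-> forall N, exists2 n, N <= n & A n.
Proof.
split=> [Ai N|AN /finite_seqP[s AE]].
  apply: contrapT => nA; apply: Ai.
  apply: (@sub_finite_set _ _ `I_N); last exact: finite_II.
  move=> n An /=; rewrite ltnNge; apply/negP => Nn; apply: nA; by exists n.
have [n ns] := AN (\max_(i <- s) i).+1; rewrite AE /= => sn.
by have := leq_bigmax_seq (F := id) n sn isT; rewrite leqNgt ns.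
Qed.

Lemma laver_above_pruned L h : is_laver L -> pruned (above L h).
Proof.
move=> [_ L0 Li]; split=> [|s [Ls hs]]; first by split.
have /infinite_set_nat/(_ (h (size s)))[m hm Lm] := Li s Ls.
exists m; split=> // i; rewrite size_rcons ltnS leq_eqVlt nth_rcons.
by case/predU1P=> [->|si]; rewrite ?ltnn ?eqxx // si hs.
Qed.

Lemma leftmost_above_ge L (h f : baire) :
  (forall n, leftmost (above L h) (mkseq f n)) -> forall n, h n <= f n.
Proof.
move=> fP n; have [[_ /(_ n)]] := fP n.+1.
by rewrite size_mkseq nth_mkseq // => ->.
Qed.

Lemma laver_leftmost_above L h : is_laver L ->
  exists f : baire, forall n, leftmost (above L h) (mkseq f n).
Proof.
move=> Ll; apply: pruned_leftmost; last exact: laver_above_pruned.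
by apply: above_tree; case: Ll.
Qed.

Lemma laver_body_above L h : is_laver L ->
  exists2 f, body L f & forall n, h n <= f n.
Proof.
move=> /(laver_leftmost_above h)[f fP]; exists f; last exact: leftmost_above_ge fP.
by move=> n; have [[]] := fP n.
Qed.

Lemma laver_body_neq L q : is_laver L -> exists2 f, body L f & f <> q.
Proof.
move=> /(laver_body_above (fun n => (q n).+1))[f Lf qf].
by exists f => // fq; have := qf 0; rewrite fq ltnn.
Qed.

Lemma is_laver_above h : is_laver (above setT h).
Proof.
split=> [||s [_ hs]]; [exact: above_tree|by split|].
apply/infinite_set_nat => N; exists (maxn N (h (size s))); first exact: leq_maxl.
split=> // i; rewrite size_rcons ltnS leq_eqVlt nth_rcons.
by case/predU1P=> [->|si]; rewrite ?ltnn ?eqxx ?leq_maxr // si hs.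
Qed.

Lemma body_above h f : body (above setT h) f -> forall n, h n <= f n.
Proof.
move=> fP n; have [_ /(_ n)] := fP n.+1.
by rewrite size_mkseq nth_mkseq // => ->.
Qed.

(** A finite sequence is kept if it has extensions of every length in [Q]; for a
    finitely branching tree [Q] these are the initial segments of the paths of [Q]. *)
Definition extendible (Q : set (seq nat)) : set (seq nat) :=
  [set s | forall n, size s <= n -> exists t, [/\ Q t, size t = n & prefix s t]].

Lemma extendible_sub Q : prefix_closed Q -> extendible Q `<=` Q.
Proof. by move=> Qp s /(_ _ (leqnn _))[t [Qt _ /Qp]]; apply. Qed.

Lemma extendible_tree Q : prefix_closed Q -> prefix_closed (extendible Q).
Proof.
move=> Qp s u /[dup] su /prefix_nthP[szsu _] uP n sn.
have [t [Qt tn ut]] := uP (maxn n (size u)) (leq_maxr _ _).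
have szt : size (take n t) = n by rewrite size_takel // tn leq_maxl.
exists (take n t); split=> //; first exact: Qp (prefix_take _ _) Qt.
have /prefixP[r tE] := prefix_trans su ut.
by rewrite tE take_cat ltnNge sn /= prefix_prefix.
Qed.

(** König's lemma, for the tree of extendible nodes instead of a single path, as
    this tree is arithmetical in [Q]. If each of the finitely many [m <= f
    (size s)] led from [s] to a node without extensions of some length, then [s]
    would have no extension of the maximal one of these lengths. *)
Lemma konig_pruned Q (f : baire) : prefix_closed Q ->
  (forall s, Q s -> forall i, i < size s -> nth 0 s i <= f i) ->
  (forall n, exists2 s, Q s & size s = n) -> pruned (extendible Q).
Proof.
move=> Qp Qf Qn; split=> [n _|s sP].
  by have [t Qt tn] := Qn n; exists t; rewrite prefix0s.
apply: contrapT => /forallNP sm.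
have /choice[k kP] m : exists n, size s < n /\
    forall t, Q t -> size t = n -> ~ prefix (rcons s m) t.
  apply: contrapT => nn; apply: (sm m) => n; rewrite size_rcons => sn.
  apply: contrapT => nt; apply: nn; exists n; split=> // t Qt tn st.
  by apply: nt; exists t.
pose N := (\max_(m < (f (size s)).+1) k m).
have kN m : m <= f (size s) -> k m <= N.
  by rewrite -ltnS => mf; exact: (leq_bigmax (Ordinal mf)).
have sN : size s < N by apply: leq_trans (kN 0 _) => //; have [] := kP 0.
have [t [Qt tN st]] := sP N (ltnW sN).
have tm : nth 0 t (size s) <= f (size s) by rewrite Qf // tN.
set m := nth 0 t (size s) in tm.
have [sk /(_ (take (k m) t))] := kP m; apply.
- exact: Qp (prefix_take _ _) Qt.
- by rewrite size_takel // tN kN.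
have : prefix (rcons s m) t by apply: prefix_rcons_nth => //; rewrite tN.
case/prefixP=> r tE; rewrite tE take_cat size_rcons.
case: ltngtP => [/(leq_trans sk)|_|<-]; rewrite ?ltnn ?subnn ?take0 ?cats0 //.
  exact: prefix_prefix.
exact: prefix_refl.
Qed.

(** The finite approximations to the statement that no [g <= f] satisfies [Q]
    along all initial segments of [g] and [f]. *)
Definition unwitnessed (Q : seq nat -> seq nat -> Prop) : set (seq nat) :=
  [set s | forall t, size t = size s ->
    (forall i, i < size s -> nth 0 t i <= nth 0 s i) -> ~ Q t s].

(** The functions [g <= f] form a compact set, so if none of them satisfies [Q]
    throughout, this is visible at a finite stage. *)
Lemma open_of_unwitnessed Q (f : baire) :
  (forall n t s, Q t s -> Q (take n t) (take n s)) ->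
  open_of (unwitnessed Q) f <->
  ~ exists g : baire, (forall n, g n <= f n) /\
      forall n, Q (mkseq g n) (mkseq f n).
Proof.
move=> Qt; split=> [[s sP sE] [g [gf /(_ (size s))]]|noG].
  rewrite -sE; apply: sP => [|i si]; first by rewrite size_mkseq.
  by rewrite nth_mkseq // [in X in _ <= X]sE nth_mkseq.
apply: contrapT => nW; apply: noG.
pose R : set (seq nat) := [set t | Q t (mkseq f (size t)) /\
  forall i, i < size t -> nth 0 t i <= f i].
have Rp : prefix_closed R.
  move=> s t /[dup] /prefixP[u tE] /prefix_nthP[st E] [Qtt tf]; split.
    have := Qt (size s) _ _ Qtt; rewrite take_mkseq //.
    by rewrite {1}tE take_size_cat.
  by move=> i si; rewrite E // tf // (leq_trans si).
have Rf s : R s -> forall i, i < size s -> nth 0 s i <= f i by case.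
have Rn n : exists2 s, R s & size s = n.
  apply: contrapT => nR; apply: nW; exists (mkseq f n); last by rewrite size_mkseq.
  move=> t; rewrite size_mkseq => tn tf Qtf; apply: nR; exists t => //.
  split=> [|i]; first by rewrite tn.
  by rewrite tn => ni; rewrite (leq_trans (tf i ni)) // nth_mkseq.
have [g gP] := pruned_body (extendible_tree Rp) (konig_pruned Rp Rf Rn).
have {gP}gR n : R (mkseq g n) by apply: extendible_sub => //; exact: gP.
exists g; split=> n; last by have [] := gR n; rewrite size_mkseq.
by have [_ /(_ n)] := gR n.+1; rewrite size_mkseq nth_mkseq // => ->.
Qed.

(** A name of [open_of W]. *)
Definition enumeration (W : set (seq nat)) : baire :=
  fun n => if `[< W (CodeSeq.decode n) >] then n.+1 else 0.

Lemma enumerationK W : enumerated (enumeration W) = W.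
Proof.
apply/seteqP; split=> s.
  by move=> [n]; rewrite /enumeration; case: asboolP => // Wn [nE];
     rewrite nE CodeSeq.codeK in Wn.
by move=> Ws; exists (CodeSeq.code s); rewrite /enumeration CodeSeq.codeK asboolT.
Qed.

(** * Recursive functions and arithmetical relations *)

Definition recursive_fun (k : nat) (t : baire -> seq nat -> nat) : Prop :=
  exists e, forall p v, size v = k -> eval p e v (t p v).

Lemma rec_proj k i : recursive_fun k (fun _ v => nth 0 v i).
Proof. by exists (Proj i). Qed.

Lemma rec_comp1 k (F : baire -> nat -> nat) t :
  recursive_fun 1 (fun p v => F p (nth 0 v 0)) ->
  recursive_fun k t -> recursive_fun k (fun p v => F p (t p v)).
Proof.
move=> [e eP] [a aP]; exists (Comp e [:: a]) => p v vk /=.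
by exists [:: t p v]; split; [split=> //; exact: aP|exact: (eP p [:: _])].
Qed.

Lemma rec_comp2 k (F : baire -> nat -> nat -> nat) t u :
  recursive_fun 2 (fun p v => F p (nth 0 v 0) (nth 0 v 1)) ->
  recursive_fun k t -> recursive_fun k u ->
  recursive_fun k (fun p v => F p (t p v) (u p v)).
Proof.
move=> [e eP] [a aP] [b bP]; exists (Comp e [:: a; b]) => p v vk /=.
exists [:: t p v; u p v]; split; last exact: (eP p [:: _; _]).
by do !split=> //; [exact: aP|exact: bP].
Qed.

Lemma rec_behead k t :
  recursive_fun k t -> recursive_fun k.+1 (fun p v => t p (behead v)).
Proof.
move=> [e eP]; exists (Comp e (map Proj (iota 1 k))) => p v vk /=.
exists (behead v); split; last by apply: eP; rewrite size_behead vk.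
case: v vk => //= x v /eqP; rewrite eqSS => /eqP <-{k eP}.
rewrite -[x :: v]/([:: x] ++ v) -[1]/(size [:: x]).
elim: v [:: x] => //= y v IH w; split; first by rewrite nth_cat ltnn subnn.
by rewrite -cat_rcons -[(size w).+1](size_rcons w y); exact: IH.
Qed.

Lemma rec_S k t : recursive_fun k t -> recursive_fun k (fun p v => (t p v).+1).
Proof.
by apply: (rec_comp1 (F := fun _ => S)); exists Succ => p v _ /=; rewrite nth0.
Qed.

Lemma rec_const k c : recursive_fun k (fun _ _ => c).
Proof. by elim: c => [|c]; [exists Zero|exact: rec_S]. Qed.

Lemma rec_oracle k t :
  recursive_fun k t -> recursive_fun k (fun p v => p (t p v)).
Proof.
by apply: (rec_comp1 (F := fun p => p)); exists Oracle => p v _ /=; rewrite nth0.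
Qed.

Lemma rec_nat k (c : nat) (h : nat -> nat -> nat) t :
  recursive_fun 2 (fun _ v => h (nth 0 v 0) (nth 0 v 1)) ->
  recursive_fun k t ->
  recursive_fun k (fun p v => nat_rec (fun=> nat) c h (t p v)).
Proof.
move=> [e eP]; apply: (rec_comp1 (F := fun _ => nat_rec _ c h)).
have [b bP] := rec_const 0 c; exists (Rec b e) => p [|x []] //= _.
elim: x => [|x IH]; first exact: bP.
by exists (nat_rec _ c h x); split=> //; exact: (eP p [:: _; _]).
Qed.

Lemma rec_nat1 k (b : nat -> nat) (h : nat -> nat -> nat -> nat) t u :
  recursive_fun 1 (fun _ v => b (nth 0 v 0)) ->
  recursive_fun 3 (fun _ v => h (nth 0 v 2) (nth 0 v 0) (nth 0 v 1)) ->
  recursive_fun k t -> recursive_fun k u ->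
  recursive_fun k (fun p v => nat_rec (fun=> nat) (b (u p v)) (h (u p v)) (t p v)).
Proof.
move=> [f fP] [e eP].
apply: (rec_comp2 (F := fun _ n x => nat_rec _ (b x) (h x) n)).
exists (Rec f e) => p [|x [|y []]] //= _.
elim: x => [|x IH]; first exact: (fP p [:: _]).
by exists (nat_rec _ (b y) (h y) x); split=> //; exact: (eP p [:: _; _; _]).
Qed.

Lemma recursive_fun_ext k t u : (forall p v, t p v = u p v) ->
  recursive_fun k t -> recursive_fun k u.
Proof. by move=> tu; congr recursive_fun; apply/funext => p; apply/funext. Qed.

Lemma rec_pred k t : recursive_fun k t -> recursive_fun k (fun p v => (t p v).-1).
Proof.
move=> /(@rec_nat k 0 (fun n _ => n) _ (rec_proj _ _)).
by apply: recursive_fun_ext => p v; case: (t p v).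
Qed.

Lemma rec_sub k t u : recursive_fun k t -> recursive_fun k u ->
  recursive_fun k (fun p v => t p v - u p v).
Proof.
move=> tk uk.
have := rec_nat1 (b := fun x => x) (h := fun _ _ z => z.-1)
  (rec_proj _ _) (rec_pred (rec_proj _ _)) uk tk.
apply: recursive_fun_ext => p v; elim: (u p v) => [|n /= ->]; first by rewrite subn0.
by rewrite subnS.
Qed.

Lemma rec_add k t u : recursive_fun k t -> recursive_fun k u ->
  recursive_fun k (fun p v => t p v + u p v).
Proof.
move=> tk uk.
have := rec_nat1 (b := fun x => x) (h := fun _ _ z => z.+1)
  (rec_proj _ _) (rec_S (rec_proj _ _)) uk tk.
apply: recursive_fun_ext => p v; elim: (u p v) => [|n /= ->]; first by rewrite addn0.
by rewrite addnS.
Qed.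

Lemma rec_iter k (h : nat -> nat) t u :
  recursive_fun 1 (fun _ v => h (nth 0 v 0)) ->
  recursive_fun k t -> recursive_fun k u ->
  recursive_fun k (fun p v => iter (t p v) h (u p v)).
Proof.
move=> hP tk uk.
have := rec_nat1 (b := fun x => x) (h := fun _ _ z => h z) (rec_proj _ _)
  (rec_comp1 (F := fun _ => h) hP (rec_proj _ _)) tk uk.
by apply: recursive_fun_ext => p v; elim: (t p v) => //= n ->.
Qed.

Lemma rec_sum k (h : nat -> nat -> nat) t u :
  recursive_fun 2 (fun _ v => h (nth 0 v 0) (nth 0 v 1)) ->
  recursive_fun k t -> recursive_fun k u ->
  recursive_fun k (fun p v => \sum_(i < t p v) h i (u p v)).
Proof.
move=> hP tk uk.
have := rec_nat1 (b := fun=> 0) (h := fun x n z => z + h n x) (rec_const _ _)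
  (rec_add (rec_proj _ _)
    (rec_comp2 (F := fun _ => h) hP (rec_proj _ _) (rec_proj _ _))) tk uk.
apply: recursive_fun_ext => p v; elim: (t p v) => [|n /= ->]; first by rewrite big_ord0.
by rewrite big_ord_recr.
Qed.

Lemma rec_double k t : recursive_fun k t -> recursive_fun k (fun p v => (t p v).*2).
Proof.
by move=> tk; apply: recursive_fun_ext (rec_add tk tk) => p v; rewrite addnn.
Qed.

Lemma rec_even k t :
  recursive_fun k t -> recursive_fun k (fun p v => nat_of_bool (~~ odd (t p v))).
Proof.
move=> /(@rec_nat k 1 (fun _ z => 1 - z) _
  (rec_sub (rec_const _ _) (rec_proj _ _))).
by apply: recursive_fun_ext => p v; elim: (t p v) => //= n ->; case: odd.
Qed.

Lemma rec_half k t : recursive_fun k t -> recursive_fun k (fun p v => (t p v)./2).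
Proof.
move=> /(@rec_nat k 0 (fun n z => n - z) _
  (rec_sub (rec_proj _ _) (rec_proj _ _))).
apply: recursive_fun_ext => p v; elim: (t p v) => //= n ->.
by rewrite uphalf_half -{1}[n]odd_double_half -addnn addnA addnK.
Qed.

(** * Decoding of finite sequences *)

(** The binary expansion of the code of [x :: s] ends in [x] zeros, preceded by
    [(code s).*2.+1]. Hence removing zeros until the number is odd isolates the
    code of [s], and [x] is the number of steps at which the number was even.
    Iterating [code] many times suffices, as [x] is less than the code. *)
Definition drop_zero (c : nat) : nat := if odd c then c else c./2.

Lemma rec_drop_zero k t :
  recursive_fun k t -> recursive_fun k (fun p v => drop_zero (t p v)).
Proof.
move=> tk; have ek := rec_even tk; have hk := rec_half tk.
have := rec_nat1 (b := fun x => x) (h := fun x _ _ => x./2) (rec_proj _ _)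
  (rec_half (rec_proj _ _)) ek tk.
by apply: recursive_fun_ext => p v; rewrite /drop_zero; case: odd.
Qed.

Lemma sum_ltn c x : \sum_(i < c) (i < x : nat) = minn c x.
Proof. by elim: c => [|c IH]; rewrite ?big_ord0 ?big_ord_recr /= ?IH; lia. Qed.

Definition code_tail (c : nat) : nat := (iter c drop_zero c)./2.
Definition code_head (c : nat) : nat :=
  \sum_(i < c) ~~ odd (iter i drop_zero c).

Lemma iter_drop_zero x s i :
  iter i drop_zero (CodeSeq.code (x :: s)) =
  2 ^ (x - i) * (CodeSeq.code s).*2.+1.
Proof.
elim: i => [|i IH]; first by rewrite subn0.
rewrite iterS IH subnS /drop_zero; case: (x - i) => [|j].
  by rewrite [0.-1]/= !expn0 !mul1n oddS odd_double.
by rewrite expnS -mulnA mul2n odd_double doubleK.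
Qed.

Lemma code_cons_gt x s : x < CodeSeq.code (x :: s).
Proof. by have /andP[] := CodeSeq.ltn_code (x :: s). Qed.

Lemma code_tailE s : code_tail (CodeSeq.code s) = CodeSeq.code (behead s).
Proof.
case: s => // x s; rewrite /code_tail iter_drop_zero.
have /ltnW/eqP -> := code_cons_gt x s.
by rewrite mul1n /= uphalf_double.
Qed.

Lemma code_headE s : code_head (CodeSeq.code s) = nth 0 s 0.
Proof.
case: s => [|x s]; first by rewrite /code_head big_ord0.
rewrite /code_head (eq_bigr (fun i => nat_of_bool (nat_of_ord i < x))).
  by rewrite sum_ltn; apply/minn_idPr/ltnW/code_cons_gt.
move=> i _; rewrite iter_drop_zero -subn_gt0; case: (x - i) => [|j].
  by rewrite expn0 mul1n oddS odd_double.
by rewrite expnS -mulnA mul2n odd_double.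
Qed.

Lemma rec_tail k t :
  recursive_fun k t -> recursive_fun k (fun p v => code_tail (t p v)).
Proof.
by move=> tk; apply/rec_half/rec_iter => //; apply/rec_drop_zero/rec_proj.
Qed.

Lemma rec_head k t :
  recursive_fun k t -> recursive_fun k (fun p v => code_head (t p v)).
Proof.
move=> tk; apply: (rec_sum (h := fun i c => ~~ odd (iter i drop_zero c))) => //.
apply: rec_even; apply: rec_iter; [exact/rec_drop_zero/rec_proj|exact: rec_proj..].
Qed.

Lemma iter_code_tail i s :
  iter i code_tail (CodeSeq.code s) = CodeSeq.code (drop i s).
Proof.
elim: i => [|i IH]; first by rewrite drop0.
by rewrite iterS IH code_tailE -drop1 drop_drop add1n.
Qed.

Lemma rec_nth k t u : recursive_fun k t -> recursive_fun k u ->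
  recursive_fun k (fun p v => nth 0 (CodeSeq.decode (t p v)) (u p v)).
Proof.
move=> tk uk.
have := rec_head (rec_iter (rec_tail (rec_proj _ _)) uk tk).
apply: recursive_fun_ext => p v; rewrite -{1}[t p v]CodeSeq.decodeK.
by rewrite iter_code_tail code_headE nth_drop addn0.
Qed.

Lemma code_gt0 s : (0 < CodeSeq.code s) = (0 < size s).
Proof. by case: s => //= x s; rewrite muln_gt0 expn_gt0. Qed.

Lemma size_code s : size s <= CodeSeq.code s.
Proof.
elim: s => //= x s IH; apply: leq_trans (leq_pmull _ _); last by rewrite expn_gt0.
by rewrite ltnS -addnn (leq_trans IH) ?leq_addr.
Qed.

Lemma rec_size k t : recursive_fun k t ->
  recursive_fun k (fun p v => size (CodeSeq.decode (t p v))).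
Proof.
move=> tk.
(* the size is the number of [i] such that dropping [i] entries leaves some;
   the double difference is the sign function *)
have := rec_sum (h := fun i c => 1 - (1 - iter i code_tail c))
  (rec_sub (rec_const _ _) (rec_sub (rec_const _ _)
    (rec_iter (rec_tail (rec_proj _ _)) (rec_proj _ _) (rec_proj _ _)))) tk tk.
apply: recursive_fun_ext => p v; rewrite -[t p v]CodeSeq.decodeK CodeSeq.codeK.
set s := CodeSeq.decode _.
rewrite (eq_bigr (fun i : 'I__ => nat_of_bool (i < size s))) => [|i _].
  by rewrite sum_ltn; apply/minn_idPr/size_code.
rewrite iter_code_tail; have := code_gt0 (drop i s); rewrite size_drop subn_gt0.
by case: (CodeSeq.code _) => [|c] <-.
Qed.

(** * Arithmetical relations *)

Lemma arithmetical_rel_ext k R S : (forall p v, R p v <-> S p v) ->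
  arithmetical_rel k R -> arithmetical_rel k S.
Proof.
by move=> RS; congr arithmetical_rel; apply/funext => p; apply/funext => v;
  apply/propext.
Qed.

Lemma arith_le k t u : recursive_fun k t -> recursive_fun k u ->
  arithmetical_rel k (fun p v => t p v <= u p v).
Proof.
move=> tk uk; apply: arith_rec.
have [e eP] := rec_sub (rec_const _ 1) (rec_sub tk uk).
exists e => p v vk; have := eP p v vk; rewrite -subn_eq0.
by case: asboolP => [/eqP ->|/negP]//; case: (t p v - u p v).
Qed.

Lemma arith_eq k t u : recursive_fun k t -> recursive_fun k u ->
  arithmetical_rel k (fun p v => t p v = u p v).
Proof.
move=> tk uk; apply: arithmetical_rel_ext (arith_and (arith_le tk uk) (arith_le uk tk)).
by move=> p v; split=> [[tu ut]|->//]; apply/eqP; rewrite eqn_leq tu.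
Qed.

Lemma arith_lt k t u : recursive_fun k t -> recursive_fun k u ->
  arithmetical_rel k (fun p v => t p v < u p v).
Proof. by move=> tk uk; exact: arith_le (rec_S tk) uk. Qed.

Lemma arith_imp k R S : arithmetical_rel k R -> arithmetical_rel k S ->
  arithmetical_rel k (fun p v => R p v -> S p v).
Proof.
move=> Rk Sk; apply: arithmetical_rel_ext (arith_not (arith_and Rk (arith_not Sk))).
move=> p v; split=> [nRS Rpv|RS [/RS ? ]//].
by apply: contrapT => nS; apply: nRS.
Qed.

Lemma arith_or k R S : arithmetical_rel k R -> arithmetical_rel k S ->
  arithmetical_rel k (fun p v => R p v \/ S p v).
Proof.
move=> Rk Sk; apply: arithmetical_rel_ext (arith_imp (arith_not Rk) Sk).
move=> p v; split=> [RS|[]//].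
by have [|/RS] := pselect (R p v); [left|right].
Qed.

Lemma arith_ex_nat k (R : baire -> nat -> seq nat -> Prop) :
  arithmetical_rel k.+1 (fun p v => R p (nth 0 v 0) (behead v)) ->
  arithmetical_rel k (fun p v => exists n, R p n v).
Proof. by move=> /arith_ex. Qed.

Lemma arith_all_nat k (R : baire -> nat -> seq nat -> Prop) :
  arithmetical_rel k.+1 (fun p v => R p (nth 0 v 0) (behead v)) ->
  arithmetical_rel k (fun p v => forall n, R p n v).
Proof.
move=> /arith_not/arith_ex/arith_not; apply: arithmetical_rel_ext => p v.
split=> [nR n|Rn [n]]; last by apply; exact: Rn.
by apply: contrapT => nRn; apply: nR; exists n.
Qed.

Lemma arith_ex_seq k (R : baire -> seq nat -> seq nat -> Prop) :
  arithmetical_rel k.+1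
    (fun p v => R p (CodeSeq.decode (nth 0 v 0)) (behead v)) ->
  arithmetical_rel k (fun p v => exists s, R p s v).
Proof.
move=> /(arith_ex_nat (R := fun p n => R p (CodeSeq.decode n))).
apply: arithmetical_rel_ext => p v; split=> [[n Rn]|[s Rs]].
  by exists (CodeSeq.decode n).
by exists (CodeSeq.code s); rewrite CodeSeq.codeK.
Qed.

Lemma arith_all_seq k (R : baire -> seq nat -> seq nat -> Prop) :
  arithmetical_rel k.+1
    (fun p v => R p (CodeSeq.decode (nth 0 v 0)) (behead v)) ->
  arithmetical_rel k (fun p v => forall s, R p s v).
Proof.
move=> /(arith_all_nat (R := fun p n => R p (CodeSeq.decode n))).
apply: arithmetical_rel_ext => p v; split=> [Rn s|Rs n]; last exact: Rs.
by rewrite -[s]CodeSeq.codeK; exact: Rn.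
Qed.

(** Definability of a family of sets of sequences. The term [t] ranges over all
    contexts, which makes the notion stable under substitution: definable sets
    can be used as atoms below any number of quantifiers. *)
Definition arith_sets (B : baire -> set (seq nat)) : Prop :=
  forall k t, recursive_fun k t ->
    arithmetical_rel k (fun p v => B p (CodeSeq.decode (t p v))).

Ltac recf := first
  [ exact: (rec_proj _ 0) | exact: (rec_proj _ 1)
  | exact: (rec_behead (rec_proj _ 0))
  | exact: (rec_behead (rec_behead (rec_proj _ 0)))
  | apply: rec_nth; recf | apply: rec_size; recf
  | match goal with tk : recursive_fun _ _ |- _ => first
      [ exact: tk | exact: (rec_behead tk)
      | exact: (rec_behead (rec_behead tk))
      | exact: (rec_behead (rec_behead (rec_behead tk))) ] end ].

Lemma arith_leftmost B : arith_sets B -> arith_sets (fun p => leftmost (B p)).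
Proof.
move=> Ba k t tk; apply: arith_and; first exact: Ba.
apply: arith_all_seq; apply: arith_all_nat.
apply: arith_imp; first by apply: Ba; recf.
do 2!(apply: arith_imp; first by apply: arith_lt; recf).
apply: arith_imp; last by apply: arith_le; recf.
apply: arith_all_nat; apply: arith_imp; first by apply: arith_lt; recf.
by apply: arith_eq; recf.
Qed.

Lemma arith_extendible B :
  arith_sets B -> arith_sets (fun p => extendible (B p)).
Proof.
move=> Ba k t tk; apply: arith_all_nat; apply: arith_imp.
  by apply: arith_le; recf.
apply: (arithmetical_rel_ext (R := fun p v => exists s, B p s /\
  size s = nth 0 v 0 /\ (size (CodeSeq.decode (t p (behead v))) <= size s /\
  forall i, i < size (CodeSeq.decode (t p (behead v))) ->
    nth 0 (CodeSeq.decode (t p (behead v))) i = nth 0 s i))).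
  move=> p v; split=> [[s [Bs [ss /prefix_nthP st]]]|[s [Bs ss st]]].
    by exists s.
  by exists s; split=> //; split=> //; apply/prefix_nthP.
apply: arith_ex_seq; apply: arith_and; first by apply: Ba; recf.
apply: arith_and; first by apply: arith_eq; recf.
apply: arith_and; first by apply: arith_le; recf.
apply: arith_all_nat; apply: arith_imp; first by apply: arith_lt; recf.
by apply: arith_eq; recf.
Qed.

(** * Closed choice reduces to the open Laver problem *)

Definition ev (z : baire) : baire := fun n => z n.*2.
Definition od (z : baire) : baire := fun n => z n.*2.+1.

Lemma bpair_ev p q : ev (bpair p q) = p.
Proof. by apply/funext => n; rewrite /ev /bpair odd_double doubleK. Qed.

Lemma bpair_od p q : od (bpair p q) = q.
Proof. by apply/funext => n; rewrite /od /bpair /= odd_double /= uphalf_double. Qed.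

(** The induction principle generated for [prog] ignores the nested sequences. *)
Lemma prog_nested_ind (P : prog -> Prop) :
  P Zero -> P Succ -> (forall i, P (Proj i)) -> P Oracle ->
  (forall f gs, P f -> foldr (fun g => and (P g)) True gs -> P (Comp f gs)) ->
  (forall f g, P f -> P g -> P (Rec f g)) -> (forall f, P f -> P (Mu f)) ->
  forall e, P e.
Proof.
move=> P0 PS PP PO PC PR PM; fix IH 1; case.
- exact: P0.
- exact: PS.
- exact: PP.
- exact: PO.
- move=> f gs; apply: PC; first exact: IH.
  elim: gs => [|g gs IHgs] /=; first exact: I.
  by split; [exact: IH|exact: IHgs].
- by move=> f g; apply: PR; exact: IH.
- by move=> f; apply: PM; exact: IH.
Qed.

Fixpoint subst_oracle (d e : prog) : prog :=
  match e with
  | Oracle => Comp Oracle [:: d]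
  | Comp f gs => Comp (subst_oracle d f) (map (subst_oracle d) gs)
  | Rec f g => Rec (subst_oracle d f) (subst_oracle d g)
  | Mu f => Mu (subst_oracle d f)
  | _ => e
  end.

(** Redirecting each oracle call from [n] to [n.*2.+1] turns a program for the
    second component of a pair into a program for the pair. *)
Lemma eval_odd_oracle e :
  exists e', forall z v y, eval (od z) e v y -> eval z e' v y.
Proof.
have [d dP] := rec_S (rec_double (rec_proj 1 0)).
exists (subst_oracle (Comp d [:: Proj 0]) e) => z.
elim/prog_nested_ind: e => //=.
- move=> v y ->; exists [:: (head 0 v).*2.+1]; split=> //; split=> //.
  by exists [:: nth 0 v 0]; split=> //; rewrite nth0; exact: (dP z [:: _]).
- move=> f gs fP gsP v y [w [gw /fP fy]]; exists w; split=> //.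
  elim: gs gsP w {fy} gw => [_ []//|g gs IH] /= [gP gsP] [|x w] // [/gP gx].
  by move=> /(IH gsP) gw; split.
- move=> f g fP gP v y; elim: (head 0 v) y => /= [|n IH] y; first exact: fP.
  by move=> [x [/IH xn /gP gy]]; exists x.
- move=> f fP v y [/fP fy fz]; split=> // z' /fz[w /fP fw]; by exists w.
Qed.

(** As every oracle names a Laver tree, the translation into characteristic
    functions amounts to a program that halts for every oracle. *)
Lemma laver_decoder LT : laver_representation LT -> exists e, forall p s,
  eval p e [:: CodeSeq.code s] (if `[< sval (LT p) s >] then 1 else 0).
Proof.
move=> [_ [[F [e eP] FP] _]]; exists e => p s.
have [q Fq qP] := FP p _ erefl; rewrite -qP; exact: eP Fq _.
Qed.

Definition coded_set (p : baire) : set (seq nat) :=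
  [set s | p (CodeSeq.code s) = 1].

Lemma char_name_coded p T : char_name p T -> coded_set p = T.
Proof.
by move=> pT; apply/seteqP; split=> s; rewrite /coded_set /= pT; case: asboolP.
Qed.

Definition undominated (p : baire) : set (seq nat) :=
  unwitnessed (fun t _ => coded_set p t).

Lemma arith_coded_ev : arith_sets (fun z => coded_set (ev z)).
Proof.
move=> k t tk; apply: arithmetical_rel_ext
  (arith_eq (rec_oracle (rec_double tk)) (rec_const _ 1)).
by move=> p v; rewrite /coded_set /ev /= CodeSeq.decodeK.
Qed.

Lemma arith_laver_od LT :
  laver_representation LT -> arith_sets (fun z => sval (LT (od z))).
Proof.
move=> /laver_decoder[e]; have [e' eP] := eval_odd_oracle e => LTe k t [a aP].
apply: arith_rec; exists (Comp e' [:: a]) => z v vk /=; exists [:: t z v].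
split; first by split=> //; exact: aP.
by have := LTe (od z) (CodeSeq.decode (t z v)); rewrite CodeSeq.decodeK => /eP.
Qed.

Lemma arith_undominated : arith_sets undominated.
Proof.
move=> k t tk; apply: arith_all_seq.
apply: arith_imp; first by apply: arith_eq; recf.
apply: arith_imp.
  apply: arith_all_nat; apply: arith_imp; first by apply: arith_lt; recf.
  by apply: arith_le; recf.
apply: arith_not; apply: arithmetical_rel_ext
  (arith_eq (rec_oracle (rec_proj _ 0)) (rec_const _ 1)).
by move=> p v; rewrite /coded_set /= CodeSeq.decodeK.
Qed.

(** The forward function of the reduction of closed choice has this form. *)
Lemma arithmetical_enumeration W : arith_sets W ->
  arithmetical (fun p => Some (enumeration (W p))).
Proof.
move=> Wa; exists (fun p v =>
  (W p (CodeSeq.decode (nth 0 v 0)) /\ nth 0 v 1 = (nth 0 v 0).+1) \/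
  (~ W p (CodeSeq.decode (nth 0 v 0)) /\ nth 0 v 1 = 0)).
  apply: arith_or; apply: arith_and.
  - exact: Wa (rec_proj _ _).
  - exact: arith_eq (rec_proj _ _) (rec_S (rec_proj _ _)).
  - exact: arith_not (Wa _ _ (rec_proj _ _)).
  - exact: arith_eq (rec_proj _ _) (rec_const _ _).
move=> p q [<-] n m /=; rewrite /enumeration; case: asboolP => Wn.
  by split=> [[[]|[]]//|<-]; left.
by split=> [[[]|[]]//|<-]; right.
Qed.

(** The default value 0 keeps the backward function of the reduction total; it is
    used on trees without paths, for which every answer is correct. *)
Definition branch (B : set (seq nat)) : baire := fun n =>
  if pselect (exists s, B s /\ size s = n.+1) is left h
  then nth 0 (projT1 (cid h)) n else 0.

Lemma arithmetical_branch B : arith_sets B ->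
  (forall p s t, B p s -> B p t -> size s = size t -> s = t) ->
  arithmetical (fun p => Some (branch (B p))).
Proof.
move=> Ba Bu; exists (fun p v =>
  (exists s, B p s /\ (size s = (nth 0 v 0).+1 /\ nth 0 s (nth 0 v 0) = nth 0 v 1)) \/
  (~ (exists s, B p s /\ size s = (nth 0 v 0).+1) /\ nth 0 v 1 = 0)).
  apply: arith_or; last first.
    apply: arith_and; last exact: arith_eq (rec_proj _ _) (rec_const _ _).
    apply/arith_not/arith_ex_seq; apply: arith_and; first by apply: Ba; recf.
    apply: arith_eq; first by recf.
    exact: rec_S (rec_behead (rec_proj _ _)).
  apply: arith_ex_seq; apply: arith_and; first by apply: Ba; recf.
  apply: arith_and; apply: arith_eq; try by recf.
    exact: rec_S (rec_behead (rec_proj _ _)).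
  exact: rec_behead (rec_proj _ 1).
move=> p q [<-] n m /=; rewrite /branch; case: pselect => [ex|nex]; last first.
  split=> [[[s [Bs [sn _]]]|[]]//|<-]; last by right.
  by case: nex; exists s.
case: cid => s [Bs sn] /=; split=> [[[t [Bt [tn <-]]]|[/(_ ex)]]//|<-].
  by rewrite (Bu p s t) // tn.
by left; exists s.
Qed.

(** For [z] the pair of a name of a tree and a solution: the part of the tree
    that the leftmost path of the Laver tree bounds. Finite pieces of this path
    are used, to stay within arithmetical definitions. *)
Definition bounded_tree (LT : baire -> laver_tree) (z : baire) : set (seq nat) :=
  [set t | coded_set (ev z) t /\
    exists s, leftmost (sval (LT (od z))) s /\ (size s = size t /\
      forall i, i < size t -> nth 0 t i <= nth 0 s i)].

Lemma arith_bounded_tree LT :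
  laver_representation LT -> arith_sets (bounded_tree LT).
Proof.
move=> hLT k t tk; apply: arith_and; first exact: arith_coded_ev.
apply: arith_ex_seq; apply: arith_and.
  by apply: (arith_leftmost (arith_laver_od hLT)); recf.
apply: arith_and; first by apply: arith_eq; recf.
apply: arith_all_nat; apply: arith_imp; first by apply: arith_lt; recf.
by apply: arith_le; recf.
Qed.

(** If the tree has a path [h], a Laver tree solving the instance has a path
    above [h], so it is not inside the open set and must avoid it; its leftmost
    path [f] then bounds a path [g] of the tree, though possibly not [h]. *)
Lemma choice_le_laver LT :
  laver_representation LT -> aW_le TC_baire (LL_open LT).
Proof.
move=> hLT; exists (fun p => Some (enumeration (undominated p))).
exists (fun z => Some (branch (leftmost (extendible (bounded_tree LT z))))).
split.
- exact: arithmetical_enumeration arith_undominated.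
- apply: arithmetical_branch => [|p s t]; last exact: leftmost_uniq.
  exact/arith_leftmost/arith_extendible/arith_bounded_tree.
move=> G GP p T /char_name_coded pT _; rewrite /weihrauch_comp /=.
have Tp : prefix_closed (coded_set p) by rewrite pT; exact: (svalP T).
pose A : open_set := exist _ (open_of (undominated p)) (ex_intro _ _ erefl).
have AE f : sval A f <-> ~ exists g : baire, (forall n, g n <= f n) /\
    body (coded_set p) g.
  apply: open_of_unwitnessed => n t _; apply: Tp; exact: prefix_take.
have nameA : open_names (enumeration (undominated p)) A.
  by rewrite /open_names enumerationK.
have LTsurj (L : laver_tree) : exists y, LT y = L.
  by case: hLT => -[LTi _ LTK] _; exists (LTi L).
have domA : mvdom (LL_open LT) A.
  have [[h hT]|nT] := pselect (body (coded_set p) !=set0).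
    have [y yE] := LTsurj (exist _ _ (is_laver_above h)).
    exists y; right; rewrite yE; apply/seteqP; split=> // f [/= /body_above hf /AE].
    by apply; exists h.
  have [y yE] := LTsurj (exist _ _ (is_laver_above (fun=> 0))).
  exists y; left; rewrite yE => f _; apply/AE => -[g [_ gT]].
  by apply: nT; exists g.
have [y [_ [-> <- yA]]] := GP _ _ nameA domA.
rewrite /=; set q := branch _; exists q, q; split=> //; rewrite {}/q.
rewrite /TC_baire -pT; case: asboolP => // -[h hT] {T pT}.
set L := sval (LT y) in yA; have Ll : is_laver L by exact: (svalP (LT y)).
(* a path above [h] rules out that the Laver tree is inside *)
have {yA} disj : body L `&` sval A = set0.
  case: yA => // LA; have [f fL hf] := laver_body_above h Ll.
  by have /AE[] := LA _ fL; exists h.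
have [f fP] : exists f : baire, forall n, leftmost L (mkseq f n).
  have [Lp L0 Li] := Ll; apply: pruned_leftmost => //; split=> // s Ls.
  by have /infinite_set_nat/(_ 0)[m _ Lm] := Li s Ls; exists m.
have [g [gf gT]] : exists g : baire, (forall n, g n <= f n) /\ body (coded_set p) g.
  apply: contrapT => /AE Af; suff : (body L `&` sval A) f by rewrite disj.
  by split=> // n; case: (fP n).
set Q := bounded_tree LT _.
have QE t : Q t <->
    coded_set p t /\ forall i, i < size t -> nth 0 t i <= f i.
  rewrite /Q /bounded_tree /= bpair_ev bpair_od -/L; split=> -[Tt tf]; split=> //.
    case: tf => s [sL [st ts]] i it.
    have -> : f i = nth 0 s i; last exact: ts.
    by rewrite (leftmost_uniq sL (fP (size s))) ?size_mkseq // nth_mkseq // st.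
  exists (mkseq f (size t)); split=> //; split; first by rewrite size_mkseq.
  by move=> i it; rewrite nth_mkseq // tf.
have Qp : prefix_closed Q.
  move=> s t /[dup] st /prefix_nthP[szst E] /QE[Tt tf]; apply/QE; split.
    exact: Tp st Tt.
  by move=> i si; rewrite E // tf // (leq_trans si).
have Qpruned : pruned (extendible Q).
  apply: (konig_pruned (f := f)) => // [s /QE[]//|n].
  exists (mkseq g n); last by rewrite size_mkseq.
  by apply/QE; split=> // i; rewrite size_mkseq => ni; rewrite nth_mkseq.
have [r rP] := pruned_leftmost (extendible_tree Qp) Qpruned.
suff -> : branch (leftmost (extendible Q)) = r.
  by move=> n; have [/(extendible_sub Qp)/QE[]] := rP n.
apply/funext => n; rewrite /branch; case: pselect => [ex|]; last first.
  by case; exists (mkseq r n.+1); rewrite size_mkseq.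
case: cid => s [sP sn] /=; rewrite (leftmost_uniq sP (rP n.+1)) ?size_mkseq //.
by rewrite nth_mkseq.
Qed.

(** * Continuity and closed conditions on Baire space *)

Definition agree (n : nat) (x y : baire) : Prop := forall i, i < n -> x i = y i.

Lemma agree_le m n x y : m <= n -> agree n x y -> agree m x y.
Proof. by move=> mn xy i im; apply: xy; exact: leq_trans mn. Qed.

Lemma agree_mkseq n x y : mkseq x n = mkseq y n -> agree n x y.
Proof. by move=> xy i ni; rewrite -(nth_mkseq 0 x ni) xy nth_mkseq. Qed.

(** With values in an arbitrary type, this covers the coordinates of continuous
    functions as well as clopen conditions (with [T := Prop]). *)
Definition loc_const (T : Type) (h : baire -> T) : Prop :=
  forall w, exists N, forall w', agree N w w' -> h w' = h w.

Lemma loc_cst T (c : T) : loc_const (fun=> c).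
Proof. by exists 0. Qed.

Lemma loc_val n : loc_const (fun w => w n).
Proof. by move=> w; exists n.+1 => w' ->. Qed.

Lemma loc_bind T U (h : baire -> T) (F : T -> baire -> U) :
  loc_const h -> (forall c, loc_const (F c)) -> loc_const (fun w => F (h w) w).
Proof.
move=> hl Fl w; have [N hN] := hl w; have [M FM] := Fl (h w) w.
exists (maxn N M) => w' ww'; rewrite hN ?FM //.
  exact: agree_le (leq_maxr _ _) ww'.
exact: agree_le (leq_maxl _ _) ww'.
Qed.

Lemma loc_app T U (F : T -> U) h : loc_const h -> loc_const (fun w => F (h w)).
Proof. by move=> hl; apply: (loc_bind (F := fun c _ => F c)) => // c; exact: loc_cst. Qed.

Lemma loc_app2 T U V (F : T -> U -> V) g h :
  loc_const g -> loc_const h -> loc_const (fun w => F (g w) (h w)).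
Proof.
by move=> gl hl; apply: (loc_bind (F := fun c w => F c (h w))) => // c; exact: loc_app.
Qed.

Definition continuous (c : baire -> baire) : Prop :=
  forall n, loc_const (fun w => c w n).

Lemma continuous_agree c : continuous c ->
  forall n w, exists N, forall w', agree N w w' -> agree n (c w) (c w').
Proof.
move=> cc; elim=> [|n IH] w; first by exists 0.
have [N NP] := IH w; have [M MP] := cc n w; exists (maxn N M) => w' ww' i.
rewrite ltnS leq_eqVlt => /predU1P[->|]; last first.
  by apply: NP; exact: agree_le (leq_maxl _ _) ww'.
by rewrite MP //; exact: agree_le (leq_maxr _ _) ww'.
Qed.

Lemma loc_comp T (h : baire -> T) c :
  loc_const h -> continuous c -> loc_const (fun w => h (c w)).
Proof.
move=> hl cc w; have [n nP] := hl (c w); have [N NP] := continuous_agree cc n w.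
by exists N => w' /NP /nP.
Qed.

Lemma loc_eval c h :
  continuous c -> loc_const h -> loc_const (fun w => c w (h w)).
Proof. by move=> cc hl; exact: (loc_bind (F := fun n w => c w n)). Qed.

Lemma loc_mkseq c n : continuous c -> loc_const (fun w => mkseq (c w) n).
Proof.
move=> cc; elim: n => [|n IH]; first exact: loc_cst.
have := loc_app2 rcons IH (cc n).
by congr loc_const; apply/funext => w; rewrite mkseqS.
Qed.

Lemma continuous_id : continuous (fun w => w).
Proof. exact: loc_val. Qed.

Lemma continuous_cst p : continuous (fun=> p).
Proof. by move=> n; exact: loc_cst. Qed.

Lemma continuous_comp c d :
  continuous c -> continuous d -> continuous (fun w => d (c w)).
Proof. by move=> cc dd n; exact: loc_comp (dd n) cc. Qed.

Lemma continuous_ev c : continuous c -> continuous (fun w => ev (c w)).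
Proof. by move=> cc n; exact: cc. Qed.

Lemma continuous_od c : continuous c -> continuous (fun w => od (c w)).
Proof. by move=> cc n; exact: cc. Qed.

Lemma continuous_bpair c d :
  continuous c -> continuous d -> continuous (fun w => bpair (c w) (d w)).
Proof. by move=> cc dd n; rewrite /bpair; case: odd; [exact: dd|exact: cc]. Qed.

Lemma bpair_ev_od z : bpair (ev z) (od z) = z.
Proof.
apply/funext => n; rewrite /bpair /ev /od -{4}[n]odd_double_half.
by case: odd.
Qed.

(** Closedness says that failure is decided by a finite part of the argument. *)
Definition is_closed (K : baire -> Prop) : Prop :=
  forall w, ~ K w -> exists N, forall w', agree N w w' -> ~ K w'.

Lemma closed_loc K : loc_const K -> is_closed K.
Proof. by move=> Kl w nK; have [N NP] := Kl w; exists N => w' /NP ->. Qed.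

Lemma closed_comp K c :
  is_closed K -> continuous c -> is_closed (fun w => K (c w)).
Proof.
move=> Kc cc w /Kc[n nP]; have [N NP] := continuous_agree cc n w.
by exists N => w' /NP /nP.
Qed.

Lemma closed_all I (K : I -> baire -> Prop) :
  (forall i, is_closed (K i)) -> is_closed (fun w => forall i, K i w).
Proof.
move=> Kc w /existsNP[i /Kc[N NP]]; exists N => w' /NP nK Kw'; exact: nK (Kw' i).
Qed.

Lemma closed_and K L : is_closed K -> is_closed L -> is_closed (fun w => K w /\ L w).
Proof.
move=> Kc Lc w /not_andP[/Kc|/Lc][N NP]; by exists N => w' /NP nK [].
Qed.

Lemma closed_or K L : is_closed K -> is_closed L -> is_closed (fun w => K w \/ L w).
Proof.
move=> Kc Lc w /not_orP[/Kc[N NP] /Lc[M MP]]; exists (maxn N M) => w' ww' [].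
  by apply: NP; exact: agree_le (leq_maxl _ _) ww'.
by apply: MP; exact: agree_le (leq_maxr _ _) ww'.
Qed.

Definition closed_graph (H : baire -> baire) : Prop :=
  is_closed (fun z => H (ev z) = od z).

Lemma closed_eq H c d : closed_graph H -> continuous c -> continuous d ->
  is_closed (fun w => H (c w) = d w).
Proof.
move=> Hc cc dd; have := closed_comp Hc (continuous_bpair cc dd).
by congr is_closed; apply/funext => w; rewrite bpair_ev bpair_od.
Qed.

Lemma closed_graph_continuous c : continuous c -> closed_graph c.
Proof.
move=> cc; have cl : is_closed (fun z => forall n, c (ev z) n = od z n).
  apply: closed_all => n; apply: closed_loc; apply: loc_app2.
    exact: loc_comp (cc n) (continuous_ev continuous_id).
  exact: continuous_od continuous_id n.
move: cl; congr is_closed; apply/funext => z; apply/propext.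
by split=> [czE|<-//]; apply/funext.
Qed.

(** * Borel functions as projections of functions with closed graph *)

(** Every Borel function is of this kind: its values are pinned down by a closed
    condition once a suitable certificate [G x] is added. As the certificate is a
    function of [x], the certificates of composed functions can be collected in
    one, and the diagonal argument can single out one point. *)
Definition certified (F : baire -> baire) : Prop :=
  exists G, closed_graph (fun x => bpair (F x) (G x)).

Lemma certified_closed_graph F : closed_graph F -> certified F.
Proof.
move=> Fc; exists (fun=> fun=> 0).
have := closed_and (closed_eq Fc (continuous_ev continuous_id)
    (continuous_ev (continuous_od continuous_id)))
  (closed_eq (closed_graph_continuous (continuous_cst (fun=> 0))) continuous_id
    (continuous_od (continuous_od continuous_id))).
congr is_closed; apply/funext => z; apply/propext; split=> [[-> ->]|<-].
  exact: bpair_ev_od.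
by rewrite bpair_ev bpair_od.
Qed.

Lemma certified_continuous c : continuous c -> certified c.
Proof. by move=> /closed_graph_continuous/certified_closed_graph. Qed.

Lemma bpair_eq p q z : bpair p q = z <-> p = ev z /\ q = od z.
Proof.
by split=> [<-|[-> ->]]; rewrite ?bpair_ev ?bpair_od // bpair_ev_od.
Qed.

(** The certificate must contain the intermediate value [F x], which cannot be
    recovered from [H (F x)] in general. *)
Lemma certified_comp F H :
  certified F -> certified H -> certified (fun x => H (F x)).
Proof.
move=> [G Gc] [I Ic]; exists (fun x => bpair (bpair (F x) (G x)) (I (F x))).
have idc := continuous_id; have oc := continuous_od idc.
have ooc := continuous_od oc; have eoc := continuous_ev oc.
have := closed_and (closed_eq Gc (continuous_ev idc) (continuous_ev ooc))
  (closed_eq Ic (continuous_ev (continuous_ev ooc))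
    (continuous_bpair eoc (continuous_od ooc))).
congr is_closed; apply/funext => z; apply/propext.
rewrite !bpair_eq bpair_ev bpair_od; split.
  by move=> [[FE GE] [HE IE]]; rewrite FE GE HE.
by move=> [HE [[FE GE] IE]]; rewrite -FE.
Qed.

Lemma certified_pair F H :
  certified F -> certified H -> certified (fun x => bpair (F x) (H x)).
Proof.
move=> [G Gc] [I Ic]; exists (fun x => bpair (G x) (I x)).
have idc := continuous_id; have oc := continuous_od idc; have xc := continuous_ev idc.
have ec := continuous_ev oc; have ooc := continuous_od oc.
have := closed_and
  (closed_eq Gc xc (continuous_bpair (continuous_ev ec) (continuous_ev ooc)))
  (closed_eq Ic xc (continuous_bpair (continuous_od ec) (continuous_od ooc))).
congr is_closed; apply/funext => z; apply/propext; rewrite !bpair_eq !bpair_ev !bpair_od.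
by split=> [[[? ?] [? ?]]|[[? ?] [? ?]]].
Qed.

(** The least witness is shifted by one, to leave 0 for its absence. *)
Definition is_least (P : nat -> Prop) (y : nat) : Prop :=
  if y is n.+1 then P n /\ forall m, m < n -> ~ P m else forall m, ~ P m.

Lemma is_least_ex P : exists y, is_least P y.
Proof.
have [[n Pn]|nP] := pselect (exists n, P n); last first.
  by exists 0 => m Pm; apply: nP; exists m.
have exP : exists n, `[< P n >] by exists n; apply/asboolP.
case: (ex_minnP exP) => m /asboolP Pm mmin; exists m.+1; split=> // k km.
by move=> /asboolP/mmin; rewrite leqNgt km.
Qed.

Lemma is_least_uniq P y z : is_least P y -> is_least P z -> y = z.
Proof.
case: y z => [|y] [|z] //=; first by move=> nP [] /nP.
- by move=> [Py _] /(_ y).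
- move=> [Py ly] [Pz lz]; congr S.
  by case: (ltngtP y z) => // [/lz|/ly].
Qed.

(** A form of the Turing jump, which accounts for number quantifiers. *)
Definition search (x : baire) : baire := fun c =>
  projT1 (cid (is_least_ex (fun n => x (CodeSeq.code (n :: CodeSeq.decode c)) <> 0))).

Lemma searchP x c :
  is_least (fun n => x (CodeSeq.code (n :: CodeSeq.decode c)) <> 0) (search x c).
Proof. by rewrite /search; case: cid. Qed.

(** The least witness serves as its own certificate: that [n] is the least
    witness is a clopen condition, that there is none is a closed one. *)
Lemma certified_search : certified search.
Proof.
apply: certified_closed_graph.
have cl : is_closed (fun z => forall c,
    is_least (fun n => ev z (CodeSeq.code (n :: CodeSeq.decode c)) <> 0) (od z c)).
  apply: closed_all => c.
  pose P n (z : baire) := ev z (CodeSeq.code (n :: CodeSeq.decode c)) <> 0.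
  have Pl n : loc_const (P n).
    by apply: (loc_app (fun x => x <> 0)); exact: continuous_ev continuous_id _.
  have Ll y : is_closed (fun z => is_least (P^~ z) y).
    case: y => [|n] /=.
      by apply: closed_all => m; apply: closed_loc; exact: loc_app.
    apply: closed_and; first exact: closed_loc.
    apply: closed_all => m; apply: closed_all => _.
    by apply: closed_loc; exact: loc_app.
  move=> z /Ll[N NP]; have [M MP] := continuous_od continuous_id c z.
  exists (maxn N M) => z' zz'; rewrite MP; last exact: agree_le (leq_maxr _ _) zz'.
  by apply: NP; exact: agree_le (leq_maxl _ _) zz'.
move: cl; congr is_closed; apply/funext => z; apply/propext; split=> [zP|<- c].
  by apply/funext => c; exact: is_least_uniq (searchP _ _) (zP c).
exact: searchP.
Qed.

(** * Arithmetical functions are Borel *)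

Lemma eval_det p e v y y' : eval p e v y -> eval p e v y' -> y = y'.
Proof.
elim/prog_nested_ind: e v y y' => /=.
- by move=> v y y' -> ->.
- by move=> v y y' -> ->.
- by move=> i v y y' -> ->.
- by move=> v y y' -> ->.
- move=> f gs fP gsP v y y' [w [gw fw]] [w' [gw' fw']].
  suff ww' : w = w' by rewrite -ww' in fw'; exact: fP fw fw'.
  elim: gs gsP w w' gw gw' {fw fw'} => [_ [] // []//|g gs IH] /= [gP gsP].
  by move=> [//|x w] [//|x' w'] [gx gw] [/(gP _ _ _ gx) -> /(IH gsP _ _ gw) ->].
- move=> f g fP gP v; elim: (head 0 v) => [|n IH] y y'; first exact: fP.
  by move=> [x [xn yg]] [x' [/(IH _ _ xn) <-]]; exact: gP yg.
- move=> f fP v y y' [fy ly] [fy' ly']; case: (ltngtP y y') => //.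
    by move=> /ly'[w /(fP _ _ _ fy)].
  by move=> /ly[w /(fP _ _ _ fy')].
Qed.

Lemma agree_max M N x y : agree (maxn M N) x y -> agree M x y /\ agree N x y.
Proof.
by move=> xy; split; apply: agree_le xy; [exact: leq_maxl|exact: leq_maxr].
Qed.

(** A halting computation uses only finitely many values of the oracle. *)
Lemma eval_use p e v y : eval p e v y ->
  exists N, forall p', agree N p p' -> eval p' e v y.
Proof.
elim/prog_nested_ind: e v y => /=.
- by move=> v y ->; exists 0.
- by move=> v y ->; exists 0.
- by move=> i v y ->; exists 0.
- by move=> v y ->; exists (head 0 v).+1 => p' ->.
- move=> f gs fP gsP v y [w [gw /fP[N NP]]].
  have [M MP] : exists M, forall p', agree M p p' ->
     (fix evals (gs : seq prog) (w : seq nat) {struct gs} : Prop :=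
           match gs, w with
           | [::], [::] => True
           | g :: gs', z :: w' => eval p' g v z /\ evals gs' w'
           | _, _ => False
           end) gs w.
    elim: gs gsP w gw {NP} => [_ [] // _|g gs IH] /=; first by exists 0.
    move=> [gP gsP]; move=> [//|x w] [/gP[N1 N1P] /(IH gsP)[N2 N2P]]; exists (maxn N1 N2).
    by move=> p' /agree_max[/N1P ? /N2P].
  by exists (maxn M N) => p' /agree_max[/MP ? /NP]; exists w.
- move=> f g fP gP v; elim: (head 0 v) => [|n IH] y; first exact: fP.
  move=> [x [/IH[N NP] /gP[M MP]]]; exists (maxn N M) => p' /agree_max[/NP ? /MP].
  by exists x.
- move=> f fP v y [/fP[N NP] ly].
  have [M MP] : exists M, forall p', agree M p p' ->
      forall z, z < y -> exists w, eval p' f (z :: v) w.+1.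
    elim: y ly {NP} => [|y IH] ly; first by exists 0.
    have [w /fP[M MP]] := ly y (ltnSn y).
    have [z /ltnW/ly//|N' N'P] := IH; exists (maxn M N') => p' /agree_max[/MP ey /N'P lz] z.
    by rewrite ltnS leq_eqVlt => /predU1P[->|/lz//]; exists w.
  by exists (maxn N M) => p' /agree_max[/NP ? /MP].
Qed.

Lemma loc_eval_fun e (v : seq nat) (h : baire -> nat) :
  (forall p, eval p e v (h p)) -> loc_const h.
Proof.
move=> he p; have [N NP] := eval_use (he p); exists N => p' /NP.
exact: eval_det (he p').
Qed.

Definition char_rel (k : nat) (R : baire -> seq nat -> Prop) (p : baire) : baire :=
  fun c => if `[< size (CodeSeq.decode c) = k /\ R p (CodeSeq.decode c) >] then 1 else 0.

(** By induction along the arithmetical hierarchy: recursive relations are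
    continuous, and an existential quantifier is an application of [search]. *)
Lemma arithmetical_certified k R :
  arithmetical_rel k R -> certified (char_rel k R).
Proof.
elim=> {k R} [k R [e eP]|k R _ IH|k R S _ RH _ SH|k R _ IH].
- apply: certified_continuous => c.
  have [cv|ncv] := pselect (size (CodeSeq.decode c) = k).
    apply: (@loc_eval_fun e (CodeSeq.decode c)) => p; rewrite /char_rel.
    have := eP p _ cv; case: (asboolP (R p _)) => Rp; case: asboolP => //.
      by case.
    by case.
  have := loc_cst 0; congr loc_const; apply/funext => p.
  by rewrite /char_rel; case: asboolP => // -[].
- have cc : continuous (fun x c => if size (CodeSeq.decode c) == k then 1 - x c else 0).
    move=> c; case: eqP => _; last exact: loc_cst.
    exact: (loc_app (fun y => 1 - y) (loc_val c)).
  have := certified_comp IH (certified_continuous cc); congr certified.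
  apply/funext => p; apply/funext => c; rewrite /char_rel.
  case: eqP => [sk|sk]; last by rewrite asboolF // => -[].
  have [Rp|nR] := pselect (R p (CodeSeq.decode c)).
    by rewrite asboolT // asboolF // => -[].
  by rewrite asboolF ?asboolT // => -[].
- have cc : continuous (fun z c => ev z c * od z c).
    move=> c; apply: (loc_app2 muln); first exact: continuous_ev continuous_id c.
    exact: continuous_od continuous_id c.
  have := certified_comp (certified_pair RH SH) (certified_continuous cc).
  congr certified; apply/funext => p; apply/funext => c; rewrite bpair_ev bpair_od.
  by rewrite /char_rel; do 3![case: asboolP => //=]; tauto.
- have cc : continuous (fun x c => if x c is 0 then 0 else 1).
    by move=> c; exact: (loc_app (fun y => if y is 0 then 0 else 1) (loc_val c)).
  have := certified_comp (certified_comp IH certified_search) (certified_continuous cc).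
  congr certified; apply/funext => p; apply/funext => c.
  have := searchP (char_rel k.+1 R p) c; rewrite /char_rel; case: search => [|n].
    move=> nR; case: asboolP => // -[sk [m Rm]]; case: (nR m).
    by rewrite CodeSeq.codeK asboolT //= sk.
  move=> -[]; rewrite CodeSeq.codeK; case: asboolP => // -[[sk] Rn] _ _.
  by rewrite asboolT //; split=> //; exists n.
Qed.

(** The value at [n] is found by searching for the least [m] in the relation
    defining [F]; this also extends [F] to a total function. *)
Lemma arithmetical_extension F : arithmetical F ->
  exists2 F', certified F' & forall p q, F p = Some q -> F' p = q.
Proof.
move=> [R /arithmetical_certified Rc FR].
(* [search] looks for the first entry of a sequence, but values come second *)
pose swap (x : baire) c := if CodeSeq.decode c is [:: m; n] then
  x (CodeSeq.code [:: n; m]) else 0.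
have swapc : continuous swap.
  move=> c; rewrite /swap; case: (CodeSeq.decode c) => [|m [|n []]] *;
    by [exact: loc_cst|exact: loc_val].
pose last (x : baire) n := (x (CodeSeq.code [:: n])).-1.
have lastc : continuous last by move=> n; exact: (loc_app predn (loc_val _)).
exists (fun p => last (search (swap (char_rel 2 R p)))).
  apply: certified_comp (certified_continuous lastc).
  apply: certified_comp certified_search.
  exact: certified_comp (certified_continuous swapc).
move=> p q /FR {}FR; apply/funext => n; rewrite /last.
have := searchP (swap (char_rel 2 R p)) (CodeSeq.code [:: n]).
rewrite CodeSeq.codeK /swap /char_rel; case: search => [|m].
  by move=> /(_ (q n))[]; rewrite !CodeSeq.codeK asboolT //; split=> //; apply/FR.
by move=> -[]; rewrite !CodeSeq.codeK; case: asboolP => // -[_ /FR].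
Qed.

(** * Diagonal open sets *)

Lemma code_le (s t : seq nat) : size t = size s ->
  (forall i, i < size s -> nth 0 t i <= nth 0 s i) ->
  CodeSeq.code t <= CodeSeq.code s.
Proof.
elim: s t => [|x s IH] [|y t] //= [ts] le_ts; apply: leq_mul.
  by rewrite leq_exp2l // (le_ts 0).
by rewrite ltnS leq_double IH // => i; exact: (le_ts i.+1).
Qed.

(** [x] is read as a set of triples of finite sequences of equal size, and an
    initial segment of [x] itself is looked up in that set. This self-application
    replaces a fixed point theorem in the diagonal argument. *)
Definition coded_pairs (x : baire) (t s : seq nat) : Prop :=
  x (CodeSeq.code (map CodeSeq.code [:: mkseq x (size s); t; s])) = 1.

Definition bounded_open (x : baire) : open_set :=
  exist _ (open_of (unwitnessed (coded_pairs x))) (ex_intro _ _ erefl).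

Definition bounded_name (x : baire) : baire :=
  enumeration (unwitnessed (coded_pairs x)).

Lemma bounded_nameP x : open_names (bounded_name x) (bounded_open x).
Proof. by rewrite /open_names enumerationK. Qed.

(** Only finitely many [t] are bounded by [s], and [code] is monotone. *)
Lemma loc_unwitnessed s : loc_const (fun x => unwitnessed (coded_pairs x) s).
Proof.
move=> x; pose c t := CodeSeq.code (map CodeSeq.code [:: mkseq x (size s); t; s]).
exists (maxn (size s) (c s).+1) => x' /agree_max[xs xc].
have xE : mkseq x' (size s) = mkseq x (size s).
  apply: (@eq_from_nth _ 0); rewrite ?size_mkseq // => i si.
  by rewrite !nth_mkseq // xs.
apply/propext; rewrite /unwitnessed /coded_pairs /= xE.
have cE t : size t = size s -> (forall i, i < size s -> nth 0 t i <= nth 0 s i) ->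
    x' (c t) = x (c t).
  move=> ts le_ts; rewrite xc // ltnS; apply: code_le => // -[|[|[|i]]] //= _.
  exact: code_le.
by split=> W t ts le_ts; have := W t ts le_ts; rewrite -/(c t) cE.
Qed.

Lemma continuous_bounded_name : continuous bounded_name.
Proof.
move=> n; apply: (loc_app (fun P : Prop => if `[< P >] then n.+1 else 0)).
exact: loc_unwitnessed.
Qed.

Definition triple (x g f : baire) : baire := bpair x (bpair g f).

(** The set of the initial segments of the triples in [K]; for closed [K] it
    determines [K]. *)
Definition closed_code (K : baire -> Prop) : baire := fun c =>
  if `[< exists x g f n, K (triple x g f) /\
       c = CodeSeq.code (map CodeSeq.code [:: mkseq x n; mkseq g n; mkseq f n]) >]
  then 1 else 0.

Lemma agree_bpair n p q p' q' :
  agree n p p' -> agree n q q' -> agree n (bpair p q) (bpair p' q').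
Proof.
move=> pp' qq' i ni; have i2 : i./2 < n by apply: leq_ltn_trans ni; lia.
by rewrite /bpair; case: odd; [exact: qq'|exact: pp'].
Qed.

Lemma bounded_open_closed_code K f : is_closed K ->
  sval (bounded_open (closed_code K)) f <->
  ~ exists g : baire, (forall n, g n <= f n) /\ K (triple (closed_code K) g f).
Proof.
move=> Kc; set e := closed_code K.
have codeI := can_inj CodeSeq.codeK.
have eP t s : coded_pairs e t s <-> exists x g f n,
    [/\ K (triple x g f), mkseq e n = mkseq x n, t = mkseq g n & s = mkseq f n].
  rewrite /coded_pairs {1}/e /closed_code; split=> [|[x [g [f' [n [Kn ex -> ->]]]]]].
    case: asboolP => // -[x [g [f' [n [Kn /codeI/(inj_map codeI)[ex tg sf]]]]]] _.
    by exists x, g, f', n; split=> //; rewrite -ex sf size_mkseq.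
  rewrite size_mkseq asboolT //; exists x, g, f', n.
  by split=> //; rewrite ex.
rewrite /bounded_open /= open_of_unwitnessed; last first.
  move=> n t s /eP[x [g [f' [m [Kn ex -> ->]]]]]; apply/eP.
  exists x, g, f', (minn n m).
  have takeE (h : baire) : take n (mkseq h m) = mkseq h (minn n m).
    case: (leqP n m) => [|/ltnW] nm; first exact: take_mkseq.
    by rewrite take_oversize ?size_mkseq.
  by split; rewrite ?takeE // -!takeE ex.
split=> nG [g [gf Kg]]; apply: nG; exists g; split=> //.
  by move=> n; apply/eP; exists e, g, f, n.
apply: contrapT => /Kc[N NP].
have /eP[x [g' [f' [n [Kn]]]]] := Kg N.
move=> ex gg' ff'; have nN : N = n by rewrite -(size_mkseq g N) gg' size_mkseq.
rewrite {N}nN in NP ex gg' ff'; apply: NP Kn.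
by apply: agree_bpair; [|apply: agree_bpair]; apply: agree_mkseq.
Qed.

(** * The open Laver problem does not reduce to closed choice *)

Lemma TC_baire_nonempty T : exists a, TC_baire T a.
Proof.
rewrite /TC_baire; case: asboolP => [[a aT]|_]; first by exists a.
by exists (fun=> 0).
Qed.

(** Realizers being arbitrary, a reduction must ask about a genuine tree and must
    work with every answer: any realizer may be changed at a single name. *)
Lemma reduction_to_choice (X Y : rep_space) (f : mvfun X Y) phi psi :
  (forall G, realizer TC_baire G -> realizer f (weihrauch_comp phi psi G)) ->
  forall p x, names p x -> mvdom f x -> exists q (T : tree),
    [/\ phi p = Some q, tree_names q T & forall a, TC_baire T a ->
      exists b y, [/\ psi (bpair p a) = Some b, names b y & f x y]].
Proof.
move=> red p x px fx.
pose P q a := exists2 T, tree_names q T & TC_baire T a.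
pose G0 q := if pselect (exists a, P q a) is left h
  then Some (projT1 (cid h)) else None.
have G0P : realizer TC_baire G0.
  move=> q T qT _; have [a Ta] := TC_baire_nonempty T.
  rewrite /G0; case: pselect => [h|[]]; last by exists a, T.
  case: cid => b /= [U qU Ub]; exists b, b; split=> //=.
  by rewrite (tree_names_fun qT qU).
have [b [y []]] := red _ G0P p x px fx; rewrite /weihrauch_comp.
case phip: (phi p) => [q|] //=; rewrite /G0; case: pselect => [h|//] _ _ _.
have [a0 [T qT _]] := h; exists q, T; split=> // a Ta.
pose G q' := if pselect (q' = q) then Some a else G0 q'.
have GP : realizer TC_baire G.
  move=> q' T' qT' domT'; rewrite /G; case: (pselect (q' = q)) => [qq'|nqq']; last first.
    exact: G0P qT' domT'.
  exists a, a; split=> //; have -> // : T' = T.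
  by apply: tree_names_fun qT' _; rewrite qq'.
have [b' [y' []]] := red _ GP p x px fx.
rewrite /weihrauch_comp phip /= /G; case: pselect => //= _ psib b'y' fxy'.
by exists b', y'.
Qed.

Definition laver_bits (LT : baire -> laver_tree) (y : baire) : baire :=
  fun c => if `[< sval (LT y) (CodeSeq.decode c) >] then 1 else 0.

Lemma coded_laver_bits LT y : coded_set (laver_bits LT y) = sval (LT y).
Proof.
by apply: char_name_coded => s; rewrite /laver_bits CodeSeq.codeK.
Qed.

Lemma continuous_laver_bits LT :
  laver_representation LT -> continuous (laver_bits LT).
Proof.
move=> /laver_decoder[e eP] n; apply: (@loc_eval_fun e [:: n]) => y.
by have := eP y (CodeSeq.decode n); rewrite CodeSeq.decodeK.
Qed.

Lemma loc_leftmost_above t h f n :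
  continuous t -> continuous h -> continuous f ->
  is_closed (fun w => leftmost (above (coded_set (t w)) (h w)) (mkseq (f w) n)).
Proof.
move=> tc hc fc.
have lB s : loc_const (fun w => above (coded_set (t w)) (h w) s).
  apply: (loc_app2 and); first exact: (loc_app (fun x => x = 1) (tc _)).
  have := loc_mkseq (size s) hc.
  move=> /(loc_app (fun u => forall i, i < size s -> nth 0 u i <= nth 0 s i)).
  congr loc_const; apply/funext => w; apply/propext.
  split=> uP i si; have := uP i si; rewrite nth_mkseq //.
apply: closed_and.
  apply: closed_loc.
  exact: (loc_bind (F := fun s w => above (coded_set (t w)) (h w) s) (loc_mkseq n fc)).
apply: closed_all => u; apply: closed_all => i; apply: closed_loc.
apply: (loc_app2 (fun A B : Prop => A -> B)) => //.
exact: (loc_app (fun s => i < size u -> i < size s ->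
  (forall j, j < i -> nth 0 u j = nth 0 s j) -> nth 0 s i <= nth 0 u i)
  (loc_mkseq n fc)).
Qed.

(** [H <x, a>] contains both the tree that the reduction asks about at the open set
    of [x] and the Laver tree that it produces from the answer [a]. *)
Lemma exists_certificate LT phi psi : laver_representation LT ->
  certified phi -> certified psi -> exists H,
    [/\ closed_graph H,
        forall x a, ev (ev (H (bpair x a))) = phi (bounded_name x) &
        forall x a, od (ev (H (bpair x a))) =
          laver_bits LT (psi (bpair (bounded_name x) a))].
Proof.
move=> hLT phiC psiC; have idc := continuous_id.
have nc : continuous (fun z => bounded_name (ev z)).
  exact: continuous_comp (continuous_ev idc) continuous_bounded_name.
have treeC : certified (fun z => phi (bounded_name (ev z))).
  exact: certified_comp (certified_continuous nc) phiC.
have laverC : certified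
    (fun z => laver_bits LT (psi (bpair (bounded_name (ev z)) (od z)))).
  apply: (certified_comp _ (certified_continuous (continuous_laver_bits hLT))).
  apply: certified_comp psiC.
  exact: certified_continuous (continuous_bpair nc (continuous_od idc)).
have [G Gc] := certified_pair treeC laverC.
by eexists; split; first exact: Gc; move=> x a; rewrite !(bpair_ev, bpair_od).
Qed.

(** Since [g] is determined by [x], and [f] by [g] and [x], at most one [f] is
    concerned. As [f] is above [g], the bound on [g] in [unwitnessed] holds. *)
Definition default_branch (H : baire -> baire) (x g f : baire) : Prop :=
  H (bpair x (fun=> 0)) = g /\
  forall n, leftmost (above (coded_set (od (ev g))) g) (mkseq f n).

(** [g] packs a path [a] of the tree asked about, a path [r] of the Laver tree
    obtained from [a], the certificate [t] of both, and the size [n] of an initial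
    segment of [r] that puts [r] into the open set of [x]. *)
Definition inside_witness (H : baire -> baire) (x g : baire) : Prop :=
  let a := ev (ev g) in let r := od (ev g) in
  let t := ev (od g) in let n := od (od g) 0 in
  [/\ H (bpair x a) = t, body (coded_set (ev (ev t))) a,
      body (coded_set (od (ev t))) r &
      unwitnessed (coded_pairs x) (mkseq r n)].

Lemma closed_body t f : continuous t -> continuous f ->
  is_closed (fun w => body (coded_set (t w)) (f w)).
Proof.
move=> tc fc; apply: closed_all => n; apply: closed_loc.
apply: (loc_app (fun x => x = 1)); apply: loc_eval => //.
exact: (loc_app CodeSeq.code (loc_mkseq n fc)).
Qed.

Definition diagonal (H : baire -> baire) (w : baire) : Prop :=
  default_branch H (ev w) (ev (od w)) (od (od w)) \/
  inside_witness H (ev w) (ev (od w)).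

Lemma closed_diagonal H : closed_graph H -> is_closed (diagonal H).
Proof.
move=> Hc; have xc := continuous_ev continuous_id.
have oc := continuous_od continuous_id.
have gc := continuous_ev oc; have fc := continuous_od oc.
have ac := continuous_ev (continuous_ev gc); have rc := continuous_od (continuous_ev gc).
have tc := continuous_ev (continuous_od gc); have nc := continuous_od (continuous_od gc) 0.
apply: closed_or.
  apply: closed_and.
    exact: closed_eq Hc (continuous_bpair xc (continuous_cst _)) gc.
  apply: closed_all => n.
  exact: loc_leftmost_above (continuous_od (continuous_ev gc)) gc fc.
have := closed_and (closed_eq Hc (continuous_bpair xc ac) tc)
  (closed_and (closed_body (continuous_ev (continuous_ev tc)) ac)
  (closed_and (closed_body (continuous_od (continuous_ev tc)) rc)
  (closed_loc (loc_bind
    (F := fun s w => unwitnessed (coded_pairs (ev w)) s)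
    (loc_bind (F := fun n w => mkseq (od (ev (ev (od w)))) n) nc
       (fun n => loc_mkseq n rc))
    (fun s => loc_comp (loc_unwitnessed s) xc))))).
congr is_closed; apply/funext => w; apply/propext.
by split=> [[? [? [? ?]]]|[? ? ? ?]].
Qed.

(** The two cases below are those of the introductory comment: whether or not the
    reduction, asked about the diagonal open set, has a path of its tree
    leading to a Laver tree that meets this open set. *)
Lemma laver_choice_irreducible LT :
  laver_representation LT -> ~ aW_le (LL_open LT) TC_baire.
Proof.
move=> hLT [phi [psi [/arithmetical_extension[phi' phiC phiE]
  /arithmetical_extension[psi' psiC psiE] red]]].
have [H [Hc Htree Hlaver]] := exists_certificate hLT phiC psiC.
pose K := diagonal H; pose e := closed_code K.
have Kc : is_closed K by exact: closed_diagonal.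
have AE f : sval (bounded_open e) f <-> ~ exists g : baire, (forall n, g n <= f n) /\
    (default_branch H e g f \/ inside_witness H e g).
  rewrite bounded_open_closed_code //.
  by split=> nG [g [gf Kg]]; apply: nG; exists g; split=> //;
    move: Kg; rewrite /K /diagonal /triple !(bpair_ev, bpair_od).
have LTsurj (L : laver_tree) : exists y, LT y = L.
  by case: hLT => -[LTi _ LTK] _; exists (LTi L).
have ask : mvdom (LL_open LT) (bounded_open e) -> exists T : tree,
    coded_set (phi' (bounded_name e)) = sval T /\ forall a, TC_baire T a ->
    exists2 b, psi' (bpair (bounded_name e) a) = b & LL_open LT (bounded_open e) b.
  move=> /(reduction_to_choice red (bounded_nameP e))[q [T [/phiE -> qT aT]]].
  exists T; split=> [|a /aT[b [y [/psiE -> -> by_]]]]; last by exists y.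
  exact: char_name_coded.
have tcT (T : tree) a : body (sval T) a -> TC_baire T a.
  by move=> Ta; rewrite /TC_baire asboolT //; exists a.
have laverT b : is_laver (sval (LT b)) by exact: (svalP (LT b)).
have [[g gP]|noW] := pselect (exists g, inside_witness H e g).
  have out f : (forall n, g n <= f n) -> ~ sval (bounded_open e) f.
    by move=> gf /AE; apply; exists g; split=> //; right.
  (* the Laver tree of all sequences above [g] avoids the open set *)
  have /ask[T [TE Tb]] : mvdom (LL_open LT) (bounded_open e).
    have [y yE] := LTsurj (exist _ _ (is_laver_above g)).
    exists y; right; rewrite yE; apply/seteqP; split=> // f [/= /body_above gf].
    exact: out.
  case: gP => tE; rewrite -tE Htree Hlaver TE => aT.
  have [b -> LLb] := Tb _ (tcT _ _ aT).
  rewrite coded_laver_bits => rL rA.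
  case: LLb => [LA|LA].
    have [f /LA fA gf] := laver_body_above g (laverT b).
    exact: out gf fA.
  suff : (body (sval (LT b)) `&` sval (bounded_open e)) (od (ev g)) by rewrite LA.
  split=> //; exists (mkseq (od (ev g)) (od (od g) 0)) => //.
  by rewrite size_mkseq.
have out_uniq f f' : ~ sval (bounded_open e) f -> ~ sval (bounded_open e) f' -> f = f'.
  have outP h : ~ sval (bounded_open e) h ->
      exists g, default_branch H e g h.
    move=> /AE/contrapT[g [_ [gh|gW]]]; first by exists g.
    by case: noW; exists g.
  move=> /outP[g [<- fP]] /outP[g' [<- fP']]; apply/funext => n.
  have := leftmost_uniq (fP n.+1) (fP' n.+1); rewrite !size_mkseq => /(_ erefl).
  by move=> /agree_mkseq; apply.
(* a Laver tree has two paths, and one of them is in the open set *)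
have inside b : LL_open LT (bounded_open e) b ->
    body (sval (LT b)) `<=` sval (bounded_open e).
  case=> // dis; have outb f : body (sval (LT b)) f -> ~ sval (bounded_open e) f.
    move=> fL fA; suff : (body (sval (LT b)) `&` sval (bounded_open e)) f by rewrite dis.
    by split.
  have [f1 /outb o1 _] := laver_body_above (fun=> 0) (laverT b).
  have [f2 /outb o2] := laver_body_neq f1 (laverT b).
  by case; exact: out_uniq.
(* the sequences above [q + 1] form a Laver tree that misses the exception [q] *)
have /ask[T [TE Tb]] : mvdom (LL_open LT) (bounded_open e).
  have [q qP] : exists q, forall f, ~ sval (bounded_open e) f -> f = q.
    have [[q qo]|nq] := pselect (exists q, ~ sval (bounded_open e) q).
      by exists q => f fo; exact: out_uniq.
    by exists (fun=> 0) => f fo; case: nq; exists f.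
  have [y yE] := LTsurj (exist _ _ (is_laver_above (fun n => (q n).+1))).
  exists y; left; rewrite yE => f /= /body_above qf.
  by apply: contrapT => /qP fq; have := qf 0; rewrite fq ltnn.
have noT a : ~ body (sval T) a.
  move=> Ta; have [b bE /inside LA] := Tb a (tcT T a Ta).
  have [r rL _] := laver_body_above (fun=> 0) (laverT b).
  have [s sW sr] := LA _ rL; apply: noW.
  exists (bpair (bpair a r) (bpair (H (bpair e a)) (fun=> size s))).
  rewrite /inside_witness !(bpair_ev, bpair_od); split=> //.
  - by rewrite Htree TE.
  - by rewrite Hlaver bE coded_laver_bits.
  - by rewrite -sr.
(* now [0] is a correct answer, which the second part of [diagonal] refutes *)
have [|b bE /inside LA] := Tb (fun=> 0).
  by rewrite /TC_baire asboolF // => -[a /noT].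
pose g := H (bpair e (fun=> 0)).
have [f fP] := laver_leftmost_above g (laverT b).
have fL : body (sval (LT b)) f by move=> n; have [[]] := fP n.
have /AE := LA f fL; apply; exists g; split; first exact: leftmost_above_ge fP.
left; split=> // n; rewrite Hlaver bE coded_laver_bits; exact: fP.
Qed.

Theorem proposition5p15 (LT : baire -> laver_tree)
    (hLT : laver_representation LT) :
  aW_le TC_baire (LL_open LT) /\ ~ aW_le (LL_open LT) TC_baire.
Proof.
by split; [exact: choice_le_laver|exact: laver_choice_irreducible].
Qed.
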